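(* Let $\Delta$ be a finite reduced root system of rank $r$ and $I\subset\{1,\dots,r\}$. Let $D_{I^c}$ be a finite subset of $\widehat Q^\vee=Q^\vee\oplus\mathbb{Z}\delta$ contained in $(Q^\vee\setminus\{0\})\oplus\mathbb{Z}\delta$, with elements $\gamma=\eta_\gamma+c_\gamma\delta$, and suppose $D_{I^c}$ contains $B_{I^c}=\{\gamma_i=\eta_i+c_i\delta\}_{i\in I^c}$ such that $\{\eta_i\}_{i\in I^c}$ is a basis of $Q_{I^c}^\vee$; let $\{\mu_i\}_{i\in I^c}\subset P_{I^c}$ be the dual basis. Let $\mathbf{k}=(k_\gamma)_{\gamma\in D_{I^c}}$ be integers with $k_\gamma\ge2$ for $\gamma\in B_{I^c}$ and $k_\gamma\ge1$ otherwise, and let $\mathbf{y}\in V_{I^c}$. Let $f,g:P\to\mathbb{C}$, $g^\sharp:P_I\to\mathbb{C}$ satisfy, for all $\lambda\in P_{I+}$, $\mu\in P_{I^c}$, $f(\lambda+\mu)=f(\lambda)e^{2\pi\sqrt{-1}\langle\mathbf{y},\mu\rangle}$ and $g(\lambda+\mu)=g^\sharp(\lambda)\prod_{\gamma\in D_{I^c}}\gamma(\lambda+\mu)^{k_\gamma}$, with $S(f,g;I;\Delta)=\sum_{\lambda\in P_{I+}\oplus P_{I^c},\,g(\lambda)\neq0}f(\lambda)/g(\lambda)$ absolutely convergent. Let $f^\sharp:P_I\to\mathbb{C}$ be $$\begin{aligned}f^\sharp(\lambda)&=(-1)^{\lvert D_{I^c}\rvert}e^{-2\pi\sqrt{-1}\langle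 \mathbf{y},\nu\rangle}\biggl(\prod_{\gamma\in D_{I^c}}\frac{(2\pi\sqrt{-1})^{k_\gamma}}{k_\gamma!}\biggr)\int_0^1\!\!\cdots\!\int_0^1\exp\Bigl(-2\pi\sqrt{-1}\sum_{\gamma\in D_{I^c}\setminus B_{I^c}}\gamma(\lambda-\nu)x_\gamma\Bigr)\\&\quad\times\Bigl(\prod_{\gamma\in D_{I^c}\setminus B_{I^c}}B_{k_\gamma}(x_\gamma)\Bigr)\biggl(\prod_{i\in I^c}B_{k_{\gamma_i}}\Bigl(\Bigl\{\langle \mathbf{y},\mu_i\rangle-\sum_{\gamma\in D_{I^c}\setminus B_{I^c}}x_\gamma\langle\eta_\gamma,\mu_i\rangle\Bigr\}\Bigr)\biggr)\prod_{\gamma\in D_{I^c}\setminus B_{I^c}}dx_\gamma,\end{aligned}$$ where $\nu=\sum_{i\in I^c}c_i\mu_i\in P_{I^c}$. Put $\lvert\mathbf{k}\rvert=\sum_{\gamma\in D_{I^c}}k_\gamma$ and $N=\lvert D_{I^c}\setminus B_{I^c}\rvert$. Then $f^\sharp$ is of the form $$f^\sharp(\lambda)=e^{-2\pi\sqrt{-1}\langle\mathbf{y},\nu\rangle}\sum_{k=0}^{\lvert\mathbf{k}\rvert}(\pi\sqrt{-1})^{\lvert\mathbf{k}\rvert-(k+N)}\sum_\eta\frac{f_\eta^{(k)}(\lambda)}{g_\eta^{(k)}(\lambda)},$$ where $\eta$ runs over a certain finite set of indices and $$f_\eta^{(k)}\in\mathbb{Q}[\mathbf{y}]\,e^{\pi\sqrt{-1}\,\mathbb{Q}\otimes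 A(\mathbf{y})\overline{D}},\qquad g_\eta^{(k)}\in\bigl(A(\mathbf{y})\overline{D}\bigr)^{k+N},$$ with vanishing denominators interpreted by analytic continuation as described in the context.
   Context: Root systems: $V$ is an $r$-dimensional real inner product space, $V^*$ is identified with $V$; $\Delta\subset V$ is a finite reduced root system, $\{\alpha_1,\dots,\alpha_r\}$ a fundamental system, $\alpha^\vee$ the coroot of $\alpha$; the fundamental weights satisfy $\langle\alpha_i^\vee,\lambda_j\rangle=\delta_{ij}$; $Q^\vee=\bigoplus_i\mathbb{Z}\alpha_i^\vee$, $P=\bigoplus_i\mathbb{Z}\lambda_i$. For $I\subset\{1,\dots,r\}$ with complement $I^c$: $V_I$ is the span of $\{\alpha_i\}_{i\in I}$, $Q_I^\vee=\bigoplus_{i\in I}\mathbb{Z}\alpha_i^\vee$, $P_I=\bigoplus_{i\in I}\mathbb{Z}\lambda_i\subset P$, $P_{I+}=\bigoplus_{i\in I}\mathbb{Z}_{\ge0}\lambda_i$. An element $\gamma=\eta+c\delta$ of $\widehat V=V\oplus\mathbb{R}\delta$ defines the affine function $\gamma(v)=\langle\eta,v\rangle+c$ on $V$. $B_k(x)$ is the $k$-th Bernoulli polynomial and $\{x\}=x-[x]$ the fractional part. Notation in the conclusion: $\mathbf{y}$ is a fixed parameter, $y_i=\langle\mathbf{y},\mu_i\rangle$ for $i\in I^c$; $\mathbb{Q}[\mathbf{y}]=\mathbb{Q}[(y_i)_{i\in I^c}]$; $A(\mathbf{y})=\sum_{i\in I^c}\mathbb{Z}y_i+\mathbb{Z}$;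 $\overline D=\{\overline\gamma:\gamma\in D_{I^c}\setminus B_{I^c}\}$ with $\overline\gamma(\lambda)=\gamma(\lambda-\nu)$. $A(\mathbf{y})\overline D$ is the set of functions $\sum_{\gamma}a_\gamma\overline\gamma$ with $a_\gamma\in A(\mathbf{y})$; $\mathbb{Q}\otimes A(\mathbf{y})\overline D$ is the same with $a_\gamma\in\sum_i\mathbb{Q}y_i+\mathbb{Q}$; $(A(\mathbf{y})\overline D)^{m}$ is the set of products of $m$ elements of $A(\mathbf{y})\overline D$; and $\mathbb{Q}[\mathbf{y}]e^{\pi\sqrt{-1}\,\mathbb{Q}\otimes A(\mathbf{y})\overline D}$ is the set of functions $\lambda\mapsto p(\mathbf{y})e^{\pi\sqrt{-1}\phi(\lambda)}$ with $p\in\mathbb{Q}[\mathbf{y}]$, $\phi\in\mathbb{Q}\otimes A(\mathbf{y})\overline D$. Interpretation of the quotient: denominators may vanish at some $\lambda$. The formula is understood as follows: replace the functions $\overline\gamma$ ($\gamma\in D_{I^c}\setminus B_{I^c}$) in the $f^{(k)}_\eta,g^{(k)}_\eta$ by independent complex variables $z_\gamma$, so that each $g^{(k)}_\eta$ becomes a product of $k+N$ nonzero linear forms in $z$ with coefficients in $A(\mathbf{y})$; the resulting total sum over $k$ and $\eta$ extends to an entire function of $z\in\mathbb{C}^N$ (the singularities are removable), and $f^\sharp(\lambda)$ is $e^{-2\pi\sqrt{-1}\langle\mathbf{y},\nu\rangle}$ times the value of this entire function at $z_\gamma=\gamma(\lambda-\nu)$. *)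

(* Defs.v *)
From HB Require Import structures.
From mathcomp Require Import all_boot all_order all_algebra finmap.
From mathcomp Require Import sesquilinear.
From mathcomp Require Import complex.
From mathcomp Require Import all_classical all_reals all_analysis.

Set Implicit Arguments.
Unset Strict Implicit.
Unset Printing Implicit Defensive.

Import Order.TTheory GRing.Theory Num.Theory.
Import numFieldNormedType.Exports.

Local Open Scope classical_set_scope.
Local Open Scope ring_scope.

Definition coroot (R : realType) (V : vectType R) (ip : {dot V for idfun})
    (a : V) : V :=
  (2 / ip a a) *: a.

Record reduced_root_system (R : realType) (V : vectType R)
    (ip : {dot V for idfun}) (Delta : {fset V}) : Prop := ReducedRootSystem {
  root_span : <<Delta>>%VS = fullv;
  root_neq0 : 0 \notin Delta;
  root_reflection : forall a b, a \in Delta -> b \in Delta ->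
    b - ip (coroot ip a) b *: a \in Delta;
  root_integral : forall a b, a \in Delta -> b \in Delta ->
    ip (coroot ip a) b \is a Num.int;
  root_reduced : forall (a : V) (c : R), a \in Delta -> c *: a \in Delta ->
    c = 1 \/ c = -1 }.

Record fundamental_system (R : realType) (V : vectType R) (r : nat)
    (Delta : {fset V}) (alpha : 'I_r -> V) : Prop := FundamentalSystem {
  simple_root : forall i, alpha i \in Delta;
  simple_basis : basis_of fullv [seq alpha i | i : 'I_r];
  simple_sign : forall b, b \in Delta -> exists c : 'I_r -> nat,
    b = \sum_i (c i)%:R *: alpha i \/ b = - \sum_i (c i)%:R *: alpha i }.

(** Families indexed by a subset [J] of [{1, ..., r}] are total functions on
  ['I_r] whose values outside [J] are irrelevant. *)

Definition Zspan (R : realType) (V : vectType R) (r : nat) (J : {set 'I_r})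
    (b : 'I_r -> V) : set V :=
  [set v | exists c : 'I_r -> int, v = \sum_(i in J) (c i)%:~R *: b i].

Definition Nspan (R : realType) (V : vectType R) (r : nat) (J : {set 'I_r})
    (b : 'I_r -> V) : set V :=
  [set v | exists c : 'I_r -> nat, v = \sum_(i in J) (c i)%:R *: b i].

Definition Zbasis (R : realType) (V : vectType R) (r : nat) (J : {set 'I_r})
    (b : 'I_r -> V) (L : set V) : Prop :=
  Zspan J b = L /\
  forall c : 'I_r -> int, \sum_(i in J) (c i)%:~R *: b i = 0 ->
    forall i, i \in J -> c i = 0.

(** [(eta, c) : V * R] stands for [eta + c delta]. *)
Definition aff (R : realType) (V : vectType R) (ip : {dot V for idfun})
    (g : V * R) (v : V) : R :=
  ip g.1 v + g.2.

Definition cexp (R : realType) (z : R[i]) : R[i] :=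
  (expR (complex.Re z))%:C%C * (cos (complex.Im z) +i* sin (complex.Im z))%C.

Definition pii (R : realType) : R[i] := (pi : R)%:C%C * 'i%C.

Definition fracpart (R : realType) (x : R) : R := x - (Num.floor x)%:~R.

(** [bernoulli_poly n] is the n-th Bernoulli polynomial.  The recursion is the
  coefficient of [t^(n+1)] in
  [(e^t - 1) * \sum_n B_n(x) t^n / n! = t * e^(x t)], solved for [B_n(x)]. *)
Fixpoint bernoulli_polys (n : nat) : seq {poly rat} :=
  if n is m.+1 then
    let s := bernoulli_polys m in
    rcons s ('X^m - (m.+1%:R)^-1 *: \sum_(j < m) 'C(m.+1, j)%:R *: s`_j)
  else [::].

Definition bernoulli_poly (n : nat) : {poly rat} := (bernoulli_polys n.+1)`_n.

Lemma size_bernoulli_polys n : size (bernoulli_polys n) = n.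
Proof. by elim: n => //= n IHn; rewrite size_rcons IHn. Qed.

Lemma nth_bernoulli_polys n j : (j < n)%N ->
  (bernoulli_polys n)`_j = bernoulli_poly j.
Proof.
elim: n => // n IHn; rewrite ltnS leq_eqVlt => /orP[/eqP -> //|jn].
by rewrite /= nth_rcons size_bernoulli_polys jn IHn.
Qed.

Lemma bernoulli_poly_sum n :
  \sum_(j < n.+1) 'C(n.+1, j)%:R *: bernoulli_poly j = n.+1%:R *: 'X^n.
Proof.
rewrite big_ord_recr /= binSn.
rewrite [bernoulli_poly n]/bernoulli_poly /= nth_rcons.
rewrite size_bernoulli_polys ltnn eqxx.
under [X in 'X^n - _ *: X]eq_bigr => j _ do
  rewrite nth_bernoulli_polys ?ltn_ord //.
by rewrite scalerBr scalerA mulfV ?pnatr_eq0 // scale1r addrC subrK.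
Qed.

Definition bernoulli (R : realType) (n : nat) (x : R) : R :=
  (map_poly ratr (bernoulli_poly n)).[x].

Definition cint01 (R : realType) (h : R -> R[i]) : R[i] :=
  ((\int[@lebesgue_measure R]_(u in `[0, 1]) complex.Re (h u))
   +i* (\int[@lebesgue_measure R]_(u in `[0, 1]) complex.Im (h u)))%C.

(** Iterated integral of [F] over [0, 1] in each of the variables listed in
  [s], the other variables being fixed to their values in [x]. *)
Fixpoint iter_cint01 (R : realType) (T : eqType) (s : seq T)
    (F : (T -> R) -> R[i]) (x : T -> R) : R[i] :=
  if s is t :: s' then
    cint01 (fun u => iter_cint01 s' F [eta x with t |-> u])
  else F x.

(** The differential is required to be [K]-linear, so that for [K = R[i]] this
  is holomorphy on the whole of [C^n]. *)
Definition entire (K : numFieldType) (n : nat) (F : 'rV[K]_n -> K) : Prop :=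
  forall z, differentiable (F : 'rV[K]_n -> K^o) z.

(** [D \ B], where [B = {gam i : i not in I}] *)
Definition Dmin (R : realType) (V : vectType R) (r : nat) (I : {set 'I_r})
    (D : {fset V * R}) (gam : 'I_r -> V * R) : {fset V * R} :=
  (D `\` [fset gam i | i in ~: I])%fset.

Definition nu_vec (R : realType) (V : vectType R) (r : nat) (I : {set 'I_r})
    (gam : 'I_r -> V * R) (mu : 'I_r -> V) : V :=
  \sum_(i in ~: I) (gam i).2 *: mu i.

Definition fsharp (R : realType) (V : vectType R) (ip : {dot V for idfun})
    (r : nat) (I : {set 'I_r}) (D : {fset V * R}) (gam : 'I_r -> V * R)
    (mu : 'I_r -> V) (k : V * R -> nat) (y : V) (lam : V) : R[i] :=
  let E := Dmin I D gam in
  let nu := nu_vec I gam mu in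
  (-1) ^+ #|` D| * cexp (- (2 * pii R * (ip y nu)%:C%C))
  * (\prod_(g <- D) ((2 * pii R) ^+ k g / ((k g)`!)%:R))
  * iter_cint01 (enum {: E})
      (fun x : E -> R =>
         cexp (- (2 * pii R *
                  (\sum_(g : E) aff ip (val g) (lam - nu) * x g)%:C%C))
         * (\prod_(g : E) bernoulli (k (val g)) (x g))%:C%C
         * (\prod_(i in ~: I)
              bernoulli (k (gam i))
                (fracpart (ip y (mu i)
                           - \sum_(g : E) x g * ip (val g).1 (mu i))))%:C%C)
      (fun=> 0).

(** [yc i] is [<y, mu_i>] and [J] is the complement of [I].  A function of
  [lambda] built from the [gamma(lambda - nu)], [gamma] in [E = D \ B], is
  obtained from a function of a vector [z] of [#|E|] independent complex
  variables, [z_gamma] being the coordinate of index [enum_rank gamma]. *)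

Definition Ay (R : realType) (r : nat) (J : {set 'I_r}) (yc : 'I_r -> R) :
    set R :=
  [set a | exists (c : 'I_r -> int) (d : int),
     a = \sum_(i in J) (c i)%:~R * yc i + d%:~R].

Definition QAy (R : realType) (r : nat) (J : {set 'I_r}) (yc : 'I_r -> R) :
    set R :=
  [set a | exists (c : 'I_r -> rat) (d : rat),
     a = \sum_(i in J) ratr (c i) * yc i + ratr d].

(** Values at [yc] of the polynomials with rational coefficients in the
  indeterminates indexed by [J]: [s] is the list of the terms, each given by
  its coefficient and its exponents. *)
Definition Qy (R : realType) (r : nat) (J : {set 'I_r}) (yc : 'I_r -> R) :
    set R :=
  [set p | exists s : seq (rat * ('I_r -> nat)),
     p = \sum_(t <- s) ratr t.1 * \prod_(i in J) yc i ^+ t.2 i].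

Definition zform (R : realType) (E : finType) (a : E -> R)
    (z : 'rV[R[i]]_#|E|) : R[i] :=
  \sum_(g : E) (a g)%:C%C * z 0 (enum_rank g).

Definition numerators (R : realType) (r : nat) (J : {set 'I_r})
    (yc : 'I_r -> R) (E : finType) : set ('rV[R[i]]_#|E| -> R[i]) :=
  [set F | exists (p : R) (b : E -> R),
     [/\ Qy J yc p, forall g, QAy J yc (b g) &
         F = fun z => p%:C%C * cexp (pii R * zform b z)]].

Definition denominators (R : realType) (r : nat) (J : {set 'I_r})
    (yc : 'I_r -> R) (E : finType) (m : nat) :
    set ('rV[R[i]]_#|E| -> R[i]) :=
  [set G | exists a : 'I_m -> E -> R,
     [/\ forall j g, Ay J yc (a j g), forall j, exists g, a j g != 0 &
         G = fun z => \prod_j zform (a j) z]].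

Definition zpoint (R : realType) (V : vectType R) (ip : {dot V for idfun})
    (E : {fset V * R}) (nu lam : V) : 'rV[R[i]]_#|{: E}| :=
  \row_j (aff ip (val (enum_val j)) (lam - nu))%:C%C.

(* Main.v *)
(** With the [gamma(lambda - nu)] replaced by independent complex variables [z_g],
  the integral defining f-sharp is the Fourier-Laplace transform over the unit
  cube of a bounded function, hence entire in [z].  On the cube the product of
  Bernoulli polynomials is a finite sum of products of affine forms and of
  indicators of affine half-spaces, with rational linear coefficients and
  constants in [sum_i Q y_i + Q]: the fractional parts only split the cube along
  finitely many hyperplanes.  Integrating such a function times
  [exp (pi i sum_g z_g psi_g(x))] in one variable, by parts, gives terms of the
  same shape, each integration dividing at least once by [pi i] times a linear
  form in [z] and each further division lowering the polynomial degree.  That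
  form is never identically zero because [z_t] occurs in the exponent only
  through [- 2 x_t] until [x_t] is integrated.  After [N] integrations a term
  therefore has [k + N] denominators with [0 <= k <= |k|]. *)

Require Import Defs.
From HB Require Import structures.
From mathcomp Require Import all_boot all_order all_algebra finmap.
From mathcomp Require Import sesquilinear.
From mathcomp Require Import complex.
From mathcomp Require Import all_classical all_reals all_analysis.
From mathcomp Require Import measurable_realfun.
From mathcomp Require Import ring lra zify.

Set Implicit Arguments.
Unset Strict Implicit.
Unset Printing Implicit Defensive.

Import Order.TTheory GRing.Theory Num.Theory.
Import numFieldNormedType.Exports.

Local Open Scope classical_set_scope.
Local Open Scope ring_scope.

(** * Iterated integrals of bounded measurable functions *)

(** Every property of an integrand has to survive the integration of one variable while the others
    stay free. Hence bounds are uniform on the cube, and the list of terms produced by an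
    integration is chosen before [x] and [z] are known. Closure of the class of terms: each
    constraint with nonzero slope in x_t bounds x_t by an affine form in the other variables. The
    minimum or maximum of two such bounds is expanded into a signed sum of indicators, and the
    endpoint is then substituted for x_t. The range of k comes from one count: the number of affine
    factors plus the number of denominators grows by at most one per integration, since a further
    division costs one affine factor. It starts at most |k|, so it ends at most |k| + N, while each
    integration contributes at least one denominator. Slopes of affine forms stay rational, so sign
    tests and the clearing of denominators depend on neither [y] nor [z]; [y] enters through
    constant terms only. The entire function is the integral itself; the sum of quotients is
    compared with it only where no denominator vanishes. *)

Lemma Re_mul (R : rcfType) (a b : R[i]) :
  complex.Re (a * b) =
  complex.Re a * complex.Re b - complex.Im a * complex.Im b.
Proof. by case: a b => ? ? []. Qed.

Lemma Im_mul (R : rcfType) (a b : R[i]) :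
  complex.Im (a * b) =
  complex.Re a * complex.Im b + complex.Im a * complex.Re b.
Proof. by case: a b => ? ? []. Qed.

Lemma Re_add (R : rcfType) (a b : R[i]) :
  complex.Re (a + b) = complex.Re a + complex.Re b.
Proof. by case: a b => ? ? []. Qed.

Lemma Im_add (R : rcfType) (a b : R[i]) :
  complex.Im (a + b) = complex.Im a + complex.Im b.
Proof. by case: a b => ? ? []. Qed.

Lemma Re_sum (R : rcfType) (S : Type) (s : seq S) (F : S -> R[i]) :
  complex.Re (\sum_(i <- s) F i) = \sum_(i <- s) complex.Re (F i).
Proof. by elim/big_ind2: _ => // ? ? ? ? <- <-; exact: Re_add. Qed.

Lemma Im_sum (R : rcfType) (S : Type) (s : seq S) (F : S -> R[i]) :
  complex.Im (\sum_(i <- s) F i) = \sum_(i <- s) complex.Im (F i).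
Proof. by elim/big_ind2: _ => // ? ? ? ? <- <-; exact: Im_add. Qed.

Lemma cexpD (R : realType) (a b : R[i]) : cexp (a + b) = cexp a * cexp b.
Proof.
case: a b => a1 a2 [b1 b2]; apply/eqP; rewrite eq_complex /cexp /= expRD.
by rewrite cosD sinD; apply/andP; split; apply/eqP; ring.
Qed.

Section Admissible.
Context {R : realType} {T : eqType}.
Implicit Types (F G : (T -> R) -> R[i]) (x : T -> R).

(** Measurability along every measurable family of points: unlike measurability
  for a fixed sigma-algebra on [T -> R], this is preserved by integrating one
  coordinate, by Tonelli on [Y * R]. *)
Definition cmeas F : Prop :=
  forall d (Y : measurableType d) (xi : Y -> T -> R),
    (forall t, measurable_fun setT (fun y => xi y t)) ->
    measurable_fun setT (fun y => complex.Re (F (xi y))) /\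
    measurable_fun setT (fun y => complex.Im (F (xi y))).

Definition unit_cube x : Prop := forall t, 0 <= x t <= 1.

(** Real and imaginary parts are bounded separately because [cint01] acts on each of them; the same
    [M] then passes through every integration over a set of mass 1. *)
Definition ReIm_le F (M : R) : Prop :=
  forall x, unit_cube x -> `|complex.Re (F x)| <= M /\ `|complex.Im (F x)| <= M.

Definition admissible F : Prop := cmeas F /\ exists M, ReIm_le F M.

Lemma unit_cube_with x t u : unit_cube x -> 0 <= u <= 1 ->
  unit_cube [eta x with t |-> u].
Proof. by move=> hx hu s /=; case: ifP. Qed.

Lemma admissible_cst c : admissible (fun=> c).
Proof.
split; first by move=> d Y xi hxi; split; exact: measurable_cst.
by exists (Num.max `|complex.Re c| `|complex.Im c|) => x _; rewrite !le_max !lexx orbT.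
Qed.

Lemma admissible_add F G : admissible F -> admissible G ->
  admissible (fun x => F x + G x).
Proof.
move=> [mF [A hA]] [mG [B hB]]; split.
  move=> d Y xi hxi; have [F1 F2] := mF _ _ _ hxi; have [G1 G2] := mG _ _ _ hxi.
  split.
    by under eq_fun do rewrite Re_add; exact: measurable_funD.
  by under eq_fun do rewrite Im_add; exact: measurable_funD.
exists (A + B) => x hx; have [? ?] := hA _ hx; have [? ?] := hB _ hx.
by rewrite Re_add Im_add; split; (apply: le_trans (ler_normD _ _) _; exact: lerD).
Qed.

Lemma admissible_mul F G : admissible F -> admissible G ->
  admissible (fun x => F x * G x).
Proof.
move=> [mF [A hA]] [mG [B hB]]; split.
  move=> d Y xi hxi; have [F1 F2] := mF _ _ _ hxi; have [G1 G2] := mG _ _ _ hxi.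
  split.
    under eq_fun do rewrite Re_mul.
    by apply: measurable_funB; exact: measurable_funM.
  under eq_fun do rewrite Im_mul.
  by apply: measurable_funD; exact: measurable_funM.
exists (A * B + A * B) => x hx; have [? ?] := hA _ hx; have [? ?] := hB _ hx.
rewrite Re_mul Im_mul; split.
  by apply: le_trans (ler_normB _ _) _; apply: lerD; rewrite normrM ler_pM.
by apply: le_trans (ler_normD _ _) _; apply: lerD; rewrite normrM ler_pM.
Qed.

Lemma admissible_sum (S : Type) (s : seq S) (F : S -> (T -> R) -> R[i]) :
  (forall i, admissible (F i)) -> admissible (fun x => \sum_(i <- s) F i x).
Proof.
move=> h; elim: s => [|i s IH].
  by under eq_fun do rewrite big_nil; exact: admissible_cst.
by under eq_fun do rewrite big_cons; exact: admissible_add.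
Qed.

Lemma admissible_prod (S : Type) (s : seq S) (F : S -> (T -> R) -> R[i]) :
  (forall i, admissible (F i)) -> admissible (fun x => \prod_(i <- s) F i x).
Proof.
move=> h; elim: s => [|i s IH].
  by under eq_fun do rewrite big_nil; exact: admissible_cst.
by under eq_fun do rewrite big_cons; exact: admissible_mul.
Qed.

Lemma admissible_coord t : admissible (fun x => (x t)%:C%C).
Proof.
split; first by move=> d Y xi hxi; split => /=; [exact: hxi|exact: measurable_cst].
exists 1 => x /(_ t)/andP[x0 x1]; rewrite /= normr0 ger0_norm //.
Qed.

Lemma admissible_cexp F : admissible F -> admissible (fun x => cexp (F x)).
Proof.
move=> [mF [A hA]].
have E x : cexp (F x) = (expR (complex.Re (F x)) * cos (complex.Im (F x)) +i*
    (expR (complex.Re (F x)) * sin (complex.Im (F x))))%C.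
  by rewrite /cexp /=; congr (_ +i* _)%C; rewrite mul0r ?subr0 ?addr0.
split.
  move=> d Y xi hxi; have [F1 F2] := mF _ _ _ hxi.
  have mE : measurable_fun setT (fun y => expR (complex.Re (F (xi y)))).
    exact: measurableT_comp F1.
  have mcos : measurable_fun setT (@cos R).
    by apply: continuous_measurable_fun; exact: continuous_cos.
  have msin : measurable_fun setT (@sin R).
    by apply: continuous_measurable_fun; exact: continuous_sin.
  split; under eq_fun do rewrite E /=.
    by apply: measurable_funM => //; exact: measurableT_comp F2.
  by apply: measurable_funM => //; exact: measurableT_comp F2.
exists (expR A) => x hx; have [h _] := hA _ hx; rewrite E /=.
have h1 : expR (complex.Re (F x)) <= expR A.
  by rewrite ler_expR (le_trans (ler_norm _)).
rewrite !normrM !(ger0_norm (expR_ge0 _)).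
split; rewrite -[leRHS]mulr1; apply: ler_pM => //; rewrite ?expR_ge0//.
  by rewrite ler_norml cos_geN1 cos_le1.
by rewrite ler_norml sin_geN1 sin_le1.
Qed.

Lemma admissible_ge0 (l : (T -> R) -> R) :
  admissible (fun x => (l x)%:C%C) -> admissible (fun x => ((0 <= l x)%R%:R)%:C%C).
Proof.
move=> [ml _]; split; last first.
  exists 1 => x hx /=; rewrite normr0; split => //.
  by case: (0 <= l x); rewrite ?normr1 ?normr0.
move=> d Y xi hxi; have /= [l1 _] := ml _ _ _ hxi.
split => /=; last exact: measurable_cst.
rewrite (_ : (fun y => _) = \1_[set y | 0 <= l (xi y)]); last first.
  apply/funext => y; rewrite indicE (_ : (y \in _) = (0 <= l (xi y)))//.
  by apply/idP/idP; rewrite in_setE.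
apply: measurable_indic.
rewrite [X in measurable X](_ : _ = setT `&` (fun y => l (xi y)) @^-1` `[0, +oo[).
  exact: l1.
by apply/seteqP; split => y /=; rewrite in_itv /= andbT; [|case].
Qed.

Lemma cmeas_cint01 F t : cmeas F ->
  cmeas (fun x => cint01 (fun u => F [eta x with t |-> u])).
Proof.
move=> mF d Y xi hxi.
have key (f : (T -> R) -> R) :
    (forall d (Y : measurableType d) (xi : Y -> T -> R),
      (forall t, measurable_fun setT (fun y => xi y t)) ->
      measurable_fun setT (fun y => f (xi y))) ->
    measurable_fun setT (fun y =>
      \int[@lebesgue_measure R]_(u in `[0, 1]) f [eta xi y with t |-> u]).
  move=> mf; rewrite /Rintegral.
  apply: measurableT_comp; first exact: fine_measurable.
  have m1 : measurable_fun setT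
     (fun yu : Y * measurableTypeR R => f [eta xi yu.1 with t |-> yu.2]).
    apply: mf => s /=; case: (s == t); first exact: measurable_snd.
    by apply: (measurableT_comp (hxi s)); exact: measurable_fst.
  have m2 : measurable_fun setT (fun yu : Y * measurableTypeR R =>
     ((fun u => (f [eta xi yu.1 with t |-> u])%:E) \_ (`[0%R, 1%R])) yu.2).
    rewrite (_ : (fun yu => _) = ((fun yu : Y * measurableTypeR R =>
       (f [eta xi yu.1 with t |-> yu.2])%:E) \_
         (snd @^-1` `[0, 1]%classic))); last first.
      apply/funext => -[a b]; rewrite !patchE /=.
      by congr (if _ then _ else _); apply/idP/idP; rewrite !in_setE.
    have msnd : measurable ((snd : Y * measurableTypeR R -> _) @^-1` `[0, 1]%classic).
      by rewrite -[X in measurable X]setTI; apply: measurable_snd => //.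
    apply: (iffLR (measurable_restrictT _ msnd)); apply/measurable_EFinP.
    exact: measurable_funTS.
  (* [cmeas] gives no integrability, so the integral is split into positive and negative parts, to
     each of which Tonelli applies. *)
  under eq_fun do rewrite integral_mkcond integralE.
  pose mu : {sigma_finite_measure set (measurableTypeR R) -> \bar R} :=
    @lebesgue_measure R.
  pose h (yu : Y * measurableTypeR R) :=
    ((fun u : R => (f [eta xi yu.1 with t |-> u])%:E) \_ `[0%R, 1%R]%classic) yu.2.
  apply: emeasurable_funB.
    rewrite [X in measurable_fun _ X](_ : _ = fubini_F mu (h^\+)%E).
      apply: measurable_fun_fubini_tonelli_F; first exact: measurable_funepos m2.
      by move=> ?; exact: funepos_ge0.
    by apply/funext => v; apply: eq_integral => u _; rewrite !funeposE.
  rewrite [X in measurable_fun _ X](_ : _ = fubini_F mu (h^\-)%E).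
    apply: measurable_fun_fubini_tonelli_F; first exact: measurable_funeneg m2.
    by move=> ?; exact: funeneg_ge0.
  by apply/funext => v; apply: eq_integral => u _; rewrite !funenegE.
split; first by apply: (key (fun x => complex.Re (F x))) => ? ? ? h; have [] := mF _ _ _ h.
by apply: (key (fun x => complex.Im (F x))) => ? ? ? h; have [] := mF _ _ _ h.
Qed.
End Admissible.

Section IteratedIntegral.
Context {R : realType} {T : eqType}.
Implicit Types (F G : (T -> R) -> R[i]) (x : T -> R).
Local Notation mu := (@lebesgue_measure R).

Lemma lebesgue_unit_itv : mu `[0%R, 1%R]%classic = 1%E.
Proof. by rewrite lebesgue_measure_itv /= lte_fin ltr01 oppr0 adde0. Qed.

Lemma integrable_slice F t x : admissible F -> unit_cube x ->
  mu.-integrable `[0, 1] (EFin \o (fun u => complex.Re (F [eta x with t |-> u]))) /\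
  mu.-integrable `[0, 1] (EFin \o (fun u => complex.Im (F [eta x with t |-> u]))).
Proof.
move=> [mF [M hM]] hx.
have [m1 m2] : measurable_fun setT
      (fun u : measurableTypeR R => complex.Re (F [eta x with t |-> u])) /\
    measurable_fun setT (fun u : measurableTypeR R => complex.Im (F [eta x with t |-> u])).
  apply: mF => s /=; case: (s == t); [exact: measurable_id|exact: measurable_cst].
have fin : (mu `[0%R, 1%R]%classic < +oo)%E.
  by rewrite lebesgue_unit_itv ltry.
have hb u : `[0, 1]%classic u -> `|complex.Re (F [eta x with t |-> u])| <= M /\
   `|complex.Im (F [eta x with t |-> u])| <= M.
  by rewrite /= in_itv /= => hu; apply: hM; exact: unit_cube_with.
split; apply: measurable_bounded_integrable => //; try exact: measurable_funTS;
  by exists M; split; rewrite ?num_real // => N MN u /hb[h1 h2];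
     rewrite /= (le_trans _ (ltW MN)).
Qed.

Lemma cint01_add F G t x : admissible F -> admissible G -> unit_cube x ->
  cint01 (fun u => F [eta x with t |-> u] + G [eta x with t |-> u]) =
  cint01 (fun u => F [eta x with t |-> u]) + cint01 (fun u => G [eta x with t |-> u]).
Proof.
move=> aF aG hx; have [F1 F2] := integrable_slice t aF hx.
have [G1 G2] := integrable_slice t aG hx; rewrite /cint01.
under eq_Rintegral do rewrite Re_add.
under [in X in (_ +i* X)%C]eq_Rintegral do rewrite Im_add.
by rewrite !RintegralD.
Qed.

Lemma cint01_scale F c t x : admissible F -> unit_cube x ->
  cint01 (fun u => c * F [eta x with t |-> u]) =
  c * cint01 (fun u => F [eta x with t |-> u]).
Proof.
move=> aF hx; have [F1 F2] := integrable_slice t aF hx; rewrite /cint01.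
have scl (a : R) f : mu.-integrable `[0, 1] (EFin \o f) ->
    mu.-integrable `[0, 1] (EFin \o (fun u => a * f u)).
  by move=> hf; apply: (integrableZl _ a hf).
under eq_Rintegral do rewrite Re_mul.
under [in X in (_ +i* X)%C]eq_Rintegral do rewrite Im_mul.
rewrite RintegralB ?RintegralD ?RintegralZl//; try exact: scl.
by case: c => c1 c2.
Qed.

Lemma eq_cint01 (f g : R -> R[i]) : (forall u, 0 <= u <= 1 -> f u = g u) ->
  cint01 f = cint01 g.
Proof.
move=> fg; rewrite /cint01; congr (_ +i* _)%C; apply: eq_Rintegral => u;
  by rewrite in_setE /= in_itv /= => /fg ->.
Qed.

Lemma cint01_bound F t M : admissible F -> ReIm_le F M ->
  ReIm_le (fun x => cint01 (fun u => F [eta x with t |-> u])) M.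
Proof.
move=> aF hM x hx; have [F1 F2] := integrable_slice t aF hx.
have key (f : R -> R) : mu.-integrable `[0, 1] (EFin \o f) ->
    (forall u, 0 <= u <= 1 -> `|f u| <= M) ->
    `|\int[mu]_(u in `[0, 1]) f u| <= M.
  move=> fi fM; apply: le_trans (le_normr_Rintegral _ fi) _ => //.
  apply: (@le_trans _ _ (\int[mu]_(u in `[0%R, 1%R]) M)).
    apply: le_Rintegral => //.
    - exact: (integrable_abse fi).
    - apply: measurable_bounded_integrable => //.
        by rewrite [X in (X < _)%E]lebesgue_unit_itv ltry.
      by exists `|M|; split; rewrite ?num_real // => N MN u _; rewrite ltW.
  by rewrite Rintegral_cst // [X in fine X]lebesgue_unit_itv mulr1.
by split; apply: key => // u hu; have [] := hM _ (unit_cube_with t hx hu).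
Qed.

Lemma admissible_cint01 F t : admissible F ->
  admissible (fun x => cint01 (fun u => F [eta x with t |-> u])).
Proof.
move=> aF; have [mF [M hM]] := aF; split; first exact: cmeas_cint01.
by exists M; exact: cint01_bound.
Qed.

Lemma admissible_iter s F : admissible F -> admissible (iter_cint01 s F).
Proof. by move=> aF; elim: s => //= t s IH; exact: admissible_cint01. Qed.

Lemma iter_cint01_bound s F M : admissible F -> ReIm_le F M ->
  ReIm_le (iter_cint01 s F) M.
Proof.
move=> aF hM; elim: s => //= t s IH.
by apply: cint01_bound => //; exact: admissible_iter.
Qed.

Lemma eq_iter_cint01 s F G : (forall x, unit_cube x -> F x = G x) ->
  forall x, unit_cube x -> iter_cint01 s F x = iter_cint01 s G x.
Proof.
move=> FG; elim: s => //= t s IH x hx.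
by apply: eq_cint01 => u hu; apply: IH; exact: unit_cube_with.
Qed.

Lemma iter_cint01_add s F G x : admissible F -> admissible G -> unit_cube x ->
  iter_cint01 s (fun x => F x + G x) x = iter_cint01 s F x + iter_cint01 s G x.
Proof.
move=> aF aG; elim: s x => //= t s IH x hx.
rewrite -cint01_add //; try exact: admissible_iter.
by apply: eq_cint01 => u hu; apply: IH; exact: unit_cube_with.
Qed.

Lemma iter_cint01_scale s F c x : admissible F -> unit_cube x ->
  iter_cint01 s (fun x => c * F x) x = c * iter_cint01 s F x.
Proof.
move=> aF; elim: s x => //= t s IH x hx.
rewrite -cint01_scale //; try exact: admissible_iter.
by apply: eq_cint01 => u hu; apply: IH; exact: unit_cube_with.
Qed.

Lemma iter_cint01_sum s (S : Type) (l : seq S) (F : S -> (T -> R) -> R[i]) x :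
  (forall i, admissible (F i)) -> unit_cube x ->
  iter_cint01 s (fun x => \sum_(i <- l) F i x) x =
  \sum_(i <- l) iter_cint01 s (F i) x.
Proof.
move=> aF hx; elim: l => [|i l IH].
  rewrite big_nil -[RHS](mul0r (iter_cint01 s (fun=> 0) x)) -iter_cint01_scale//.
    by apply: eq_iter_cint01 => // z _; rewrite big_nil mul0r.
  exact: admissible_cst.
rewrite big_cons -IH -iter_cint01_add //; last exact: admissible_sum.
by apply: eq_iter_cint01 => // z _; rewrite big_cons.
Qed.
End IteratedIntegral.

(** * The integral is entire in [z] *)

Section CexpExpansion.
Context {R : realType}.

(** Each of the next three estimates uses the previous one as the bound on the derivative. *)
Lemma norm_le_MVT (f df : R -> R) (C t : R) : f 0 = 0 ->
  (forall x : R, is_derive x 1 f (df x)) -> (forall x, `|x| <= `|t| -> `|df x| <= C) ->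
  `|f t| <= C * `|t|.
Proof.
move=> f0 fd hC.
have cf (a b : R) : {within `[a, b], continuous f}.
  by apply: derivable_within_continuous => x _; have [] := fd x.
have [t0|t0] := leP 0 t.
  have [c cin E] := MVT_segment t0 (fun x _ => fd x) (cf _ _).
  move: cin; rewrite in_itv /= => /andP[c0 ct].
  rewrite -[f t]subr0 -f0 E subr0 normrM ler_wpM2r //.
  by apply: hC; rewrite !ger0_norm // (le_trans c0).
have [c cin E] := MVT_segment (ltW t0) (fun x _ => fd x) (cf _ _).
move: cin; rewrite in_itv /= => /andP[c0 ct].
rewrite -normrN -[- f t]add0r -f0 E sub0r normrM normrN ler_wpM2r //.
by apply: hC; rewrite !ler0_norm ?lerN2 // ltW.
Qed.

Lemma sin_bound (t : R) : `|sin t| <= `|t|.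
Proof.
rewrite -[leRHS]mul1r; apply: (@norm_le_MVT sin cos); first exact: sin0.
by move=> x _; exact: cos_max.
Qed.

Lemma cos_bound (t : R) : `|cos t - 1| <= `|t| ^+ 2.
Proof.
rewrite expr2; apply: (@norm_le_MVT (fun x => cos x - 1) (fun x => - sin x)).
- by rewrite cos0 subrr.
- by move=> x; rewrite -[- sin x]subr0; apply: (@is_deriveB _ _ _ cos (cst 1)).
- by move=> x h; rewrite normrN (le_trans (sin_bound x)).
Qed.

Lemma sin_sub_bound (t : R) : `|t| <= 1 -> `|sin t - t| <= `|t| ^+ 2.
Proof.
move=> t1; rewrite expr2; apply: (@norm_le_MVT (fun x => sin x - x) (fun x => cos x - 1)).
- by rewrite sin0 subrr.
- move=> x h; rewrite (le_trans (cos_bound x)) // expr2.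
  by rewrite (le_trans _ h) // ler_piMr // (le_trans h).
Qed.

Lemma expR_bound (s : R) : `|s| <= 2^-1 -> `|expR s - 1 - s| <= 2 * `|s| ^+ 2.
Proof.
(* From exp(-s) >= 1 - s one gets (1 - s) exp(s) <= 1, so exp(s) - 1 - s <= s^2 / (1 - s) <= 2 s^2
   for |s| <= 1/2; the lower bound is 1 + s <= exp(s). *)
move=> hs; have := expR_ge1Dx s; have := expR_ge1Dx (- s).
rewrite expRN => h1 h2; have h3 := expR_gt0 s.
have h4 : (1 - s) * expR s <= 1 by rewrite -ler_pdivlMr // mul1r.
rewrite real_normK ?num_real //.
move: hs; rewrite !ler_norml => /andP[? ?]; apply/andP; split; nra.
Qed.

(** An explicit second-order remainder, uniform in [b], so that it can be integrated over the cube
    without any limit under the integral sign. *)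
Lemma cexp_expansion (b : R[i]) (e : R) : 0 <= e <= 2^-1 ->
  `|complex.Re b| <= e -> `|complex.Im b| <= e ->
  `|complex.Re (cexp b - 1 - b)| <= 8 * e ^+ 2 /\
  `|complex.Im (cexp b - 1 - b)| <= 8 * e ^+ 2.
Proof.
case: b => s t /= /andP[e0 e1] hs ht; rewrite !mul0r !subr0 !addr0.
have A := expR_bound (le_trans hs e1).
have B := cos_bound t; have C := sin_sub_bound (le_trans ht (le_trans e1 _)).
have {}C : `|sin t - t| <= `|t| ^+ 2 by apply: C; lra.
have s2 : `|s| ^+ 2 <= e ^+ 2 by rewrite lerXn2r ?nnegrE.
have t2 : `|t| ^+ 2 <= e ^+ 2 by rewrite lerXn2r ?nnegrE.
have E : `|expR s - 1| <= 2 * e.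
  have -> : expR s - 1 = (expR s - 1 - s) + s by ring.
  by rewrite (le_trans (ler_normD _ _)) //; nra.
have E2 : `|expR s| <= 2.
  have -> : expR s = (expR s - 1) + 1 by ring.
  by rewrite (le_trans (ler_normD _ _)) // normr1; nra.
split.
  have -> : expR s * cos t - 1 - s = (expR s - 1 - s) + expR s * (cos t - 1) by ring.
  rewrite (le_trans (ler_normD _ _)) // normrM.
  have : `|expR s| * `|cos t - 1| <= 2 * e ^+ 2 by apply: ler_pM => //; lra.
  nra.
have -> : expR s * sin t - t = expR s * (sin t - t) + (expR s - 1) * t by ring.
rewrite (le_trans (ler_normD _ _)) // !normrM.
have : `|expR s| * `|sin t - t| <= 2 * e ^+ 2 by apply: ler_pM => //; lra.
have : `|expR s - 1| * `|t| <= 2 * e * e by apply: ler_pM.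
nra.
Qed.
End CexpExpansion.

Section EntireCriterion.
Context {K : numFieldType} {n : nat}.

Definition dotform (c : 'I_n -> K) (w : 'rV[K]_n) : K^o := \sum_j w 0 j * c j.

Lemma dotform_is_linear c : linear (dotform c).
Proof.
move=> a u v; rewrite /dotform scaler_sumr -big_split; apply: eq_bigr => g _.
by rewrite !mxE mulrDl -mulrA.
Qed.

HB.instance Definition _ c :=
  GRing.isLinear.Build K 'rV[K]_n K^o *:%R (dotform c) (dotform_is_linear c).

Lemma dotform_continuous c : continuous (dotform c).
Proof.
rewrite /dotform; elim: (index_enum _) => [|j l IH] w.
  rewrite (_ : (fun _ => _) = cst 0); first exact: cst_continuous.
  by apply/funext => v; rewrite big_nil.
rewrite (_ : (fun _ => _) = (fun v : 'rV[K]_n => v 0 j * c j : K^o) \+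
    (fun v => \sum_(j <- l) v 0 j * c j)).
  apply: cvgD; [exact: (nbhs_filter w)| |exact: IH].
  by apply: (@continuousM _ _ (fun v : 'rV[K]_n => v 0 j) (fun=> c j) w);
    [exact: coord_continuous|exact: cst_continuous].
by apply/funext => v; rewrite big_cons.
Qed.

(** Bounds on integrals come as estimates with explicit candidate partial derivatives [c]. Such an
    expansion determines the differential, which is [dotform c] and is continuous. *)
Lemma entire_expansion (F : 'rV[K]_n -> K) :
  (forall z, exists c : 'I_n -> K, forall e, 0 < e -> exists2 d, 0 < d &
     forall w, `|w| < d ->
       `|F (z + w) - F z - \sum_j w 0 j * c j| <= e * `|w|) ->
  entire F.
Proof.
move=> h z; have [c hc] := h z.
have Lo : (F : 'rV[K]_n -> K^o) \o shift z = cst (F z : K^o) + dotform c +o_ 0 id.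
  apply/eqaddoP => e e0; have [d d0 hd] := hc e e0.
  apply: filterS (pseudometric_normed_Zmodule.nbhs0_lt d0) => w /hd.
  by rewrite /= !fctE /= opprD addrA (addrC w z).
apply/diff_locallyP.
have -> := diff_unique (@dotform_continuous c) Lo.
by split => //; exact: dotform_continuous.
Qed.
End EntireCriterion.

Section Entire.
Context {R : realType} {E : finType}.
Local Notation C := R[i].
Implicit Types (w z : 'rV[C]_#|E|) (x : E -> R).

Lemma normC_le_ReIm (c : C) :
  `|c| <= (`|complex.Re c| + `|complex.Im c|)%:C%C.
Proof.
case: c => a b; rewrite normc_def lecR /= -[leRHS]ger0_norm ?addr_ge0 //.
rewrite -sqrtr_sqr ler_wsqrtr // sqrrD !real_normK ?num_real //.
by rewrite addrAC lerDl mulrn_wge0 // mulr_ge0.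
Qed.

Lemma coord_le_mx_norm w j : `|w 0 j| <= `|w|.
Proof.
rewrite [leRHS]/Num.norm /= mx_normE.
set B := (X in _ <= X%:num).
have /bigmax_leP[_ /(_ (0, j) isT)] := lexx B.
by rewrite -num_le.
Qed.

(** The norm of a complex row is itself an element of [R[i]]; this moves the estimates to [R]. *)
Lemma Re_normr w : (complex.Re `|w|)%:C%C = `|w|.
Proof. by apply: RRe_real; apply: ger0_real. Qed.

Lemma Im_coord_le w j :
  `|complex.Re (w 0 j)| <= complex.Re `|w| /\
  `|complex.Im (w 0 j)| <= complex.Re `|w|.
Proof.
have h := coord_le_mx_norm w j; rewrite -!lecR Re_normr; split.
  exact: le_trans (normc_ge_Re _) h.
apply: le_trans h; case: (w 0 j) => a b; rewrite normc_def lecR /=.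
by rewrite -sqrtr_sqr ler_wsqrtr // lerDr sqr_ge0.
Qed.

Lemma admissible_zform z : admissible (fun x => zform x z).
Proof.
apply: admissible_sum => g; apply: admissible_mul; first exact: admissible_coord.
exact: admissible_cst.
Qed.

Lemma admissible_char z : admissible (fun x => - (2 * pii R * zform x z)).
Proof.
under eq_fun do rewrite -mulNr.
apply: admissible_mul; [exact: admissible_cst|exact: admissible_zform].
Qed.

Lemma zformD x z w : zform x (z + w) = zform x z + zform x w.
Proof. by rewrite -big_split; apply: eq_bigr => g _; rewrite mxE mulrDr. Qed.

Lemma char_bound w :
  ReIm_le (fun x => - (2 * pii R * zform x w))
    (2 * pi * (#|E|%:R * complex.Re `|w|)).
Proof.
move=> x hx.
have [h1 h2] : `|complex.Re (zform x w)| <= #|E|%:R * complex.Re `|w| /\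
               `|complex.Im (zform x w)| <= #|E|%:R * complex.Re `|w|.
  have key (f : E -> R) : (forall g, `|f g| <= complex.Re `|w|) ->
      `|\sum_g x g * f g| <= #|E|%:R * complex.Re `|w|.
    move=> hf; apply: le_trans (ler_norm_sum _ _ _) _.
    rewrite mulr_natl -sumr_const; apply: ler_sum => g _.
    have /andP[x0 x1] := hx g; rewrite normrM ger0_norm //.
    by rewrite -[leRHS]mul1r ler_pM.
  rewrite Re_sum Im_sum.
  under eq_bigr do rewrite Re_mul /= mul0r subr0.
  under [X in _ /\ `|X| <= _]eq_bigr do rewrite Im_mul /= mul0r addr0.
  by split; apply: key => g; have [] := Im_coord_le w (enum_rank g).
have -> : - (2 * pii R * zform x w) =
    ((2 * pi * complex.Im (zform x w)) +i* (- (2 * pi * complex.Re (zform x w))))%C.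
  rewrite /pii; case: (zform x w) => a b.
  by apply/eqP; rewrite eq_complex /=; apply/andP; split; apply/eqP; ring.
rewrite /= normrN !normrM !(ger0_norm (pi_ge0 R)) ger0_norm //.
by split; apply: ler_wpM2l => //; rewrite mulr_ge0 // pi_ge0.
Qed.

Lemma entire_iter_cint01 (rho : (E -> R) -> C) s c x0 :
  admissible rho -> unit_cube x0 ->
  entire (fun z => c * iter_cint01 s
    (fun x => cexp (- (2 * pii R * zform x z)) * rho x) x0).
Proof.
move=> arho hx0; set F := (fun z => _); apply: entire_expansion => z.
pose h x := cexp (- (2 * pii R * zform x z)) * rho x.
have ah : admissible h.
  by apply: admissible_mul => //; apply: admissible_cexp; exact: admissible_char.
(* The partial derivatives obtained by differentiating formally under the integral sign. *)
pose cg (j : 'I_#|E|) := c * iter_cint01 s (fun x => - (2 * pii R * (x (enum_val j))%:C%C) * h x) x0.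
have LE w : \sum_j w 0 j * cg j = c * iter_cint01 s (fun x => - (2 * pii R * zform x w) * h x) x0.
  have aj (j : 'I_#|E|) : admissible (fun x : E -> R => - (2 * pii R * (x (enum_val j))%:C%C) * h x).
    apply: admissible_mul => //; under eq_fun do rewrite -mulNr.
    by apply: admissible_mul; [exact: admissible_cst|exact: admissible_coord].
  under eq_bigr do rewrite mulrCA -iter_cint01_scale //.
  rewrite -mulr_sumr -iter_cint01_sum //; last first.
    by move=> j; apply: admissible_mul => //; exact: admissible_cst.
  congr (_ * _); apply: eq_iter_cint01 => // x _.
  rewrite /zform [in RHS](reindex (fun j : 'I_#|E| => enum_val j)) /=; last first.
    by exists enum_rank => j _; rewrite ?enum_valK ?enum_rankK.
  rewrite mulr_sumr -sumrN mulr_suml; apply: eq_bigr => j _.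
  rewrite enum_valK; ring.
(* Since cexp(v + v') = cexp(v) cexp(v'), the whole error at z + w is the integral of [h] times this
   remainder, which depends on [w] only. *)
pose r w x := (cexp (- (2 * pii R * zform x w)) - 1
    - (- (2 * pii R * zform x w))).
have ar w : admissible (r w).
  apply: admissible_add; last first.
    under eq_fun do rewrite opprK.
    apply: admissible_mul; [exact: admissible_cst|exact: admissible_zform].
  apply: admissible_add; last exact: admissible_cst.
  by apply: admissible_cexp; exact: admissible_char.
have FE w : F (z + w) - F z - \sum_j w 0 j * cg j =
    c * iter_cint01 s (fun x => r w x * h x) x0.
  rewrite LE /F -/h -addrA -opprD; apply/eqP; rewrite subr_eq; apply/eqP.
  have aL : admissible (fun x => - (2 * pii R * zform x w) * h x).
    by apply: admissible_mul => //; exact: admissible_char.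
  have arh := admissible_mul (ar w) ah.
  rewrite -!mulrDr -!iter_cint01_add //; try exact: admissible_add.
  congr (_ * _); apply: eq_iter_cint01 => // x _.
  rewrite zformD mulrDr opprD cexpD /r /h.
  move: (- (2 * pii R * zform x w)) => v.
  move: (cexp (- _)) (cexp v) (rho x) => e1 e2 p; ring.
exists cg => e e0.
have [A hA] : exists A, ReIm_le h A by case: ah.
have A0 : 0 <= A by have [/(le_trans (normr_ge0 _))] := hA _ hx0.
have [c1 [c1_ge0 hc1]] : exists c1, 0 <= c1 /\ `|c| = c1%:C%C.
  by exists (complex.Re `|c|); rewrite -ler0c RRe_real ?ger0_real.
(* The exponent at [w] is at most [m * |w|] on the cube; the summand 1 makes [m] invertible when [E]
   is empty. *)
pose m : R := 2 * pi * #|E|%:R + 1.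
have m1 : 1 <= m by rewrite lerDr !mulr_ge0 // pi_ge0.
have eE : (complex.Re e)%:C%C = e by rewrite RRe_real // gtr0_real.
have e0' : 0 < complex.Re e by rewrite -ltcR eE.
(* 32 = 4 * 8: the remainder bound 8 (m |w|)^2 is multiplied by [A] in two products, for each of the
   two parts. The summand 1 keeps [B] positive when [c] or [A] is 0. *)
pose B : R := c1 * (32 * m ^+ 2 * A) + 1.
have B1 : 1 <= B by rewrite lerDr !mulr_ge0 // ?sqr_ge0 // ; lra.
(* The first bound makes the exponent at most 1/2, as [cexp_expansion] requires; the second turns
   the quadratic error into at most e |w|. *)
pose d := Num.min (2^-1 / m) (complex.Re e / B).
have d0 : 0 < d.
  by rewrite lt_min !divr_gt0 //; lra.
exists d%:C%C; first by rewrite ltcR.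
move=> w wd; rewrite FE normrM hc1.
set om := complex.Re `|w|.
have omE : om%:C%C = `|w| by exact: Re_normr.
have om0 : 0 <= om by rewrite -ler0c omE.
have [om1 om2] : om < 2^-1 / m /\ om < complex.Re e / B.
  by apply/andP; rewrite -lt_min -ltcR omE.
have hb : ReIm_le (fun x => r w x * h x) (8 * (m * om) ^+ 2 * A + 8 * (m * om) ^+ 2 * A).
  move=> x hx; have [z1 z2] := char_bound w hx.
  have mo : 2 * pi * (#|E|%:R * om) <= m * om.
    by rewrite mulrA ler_wpM2r // lerDl.
  have [] := @cexp_expansion _ (- (2 * pii R * zform x w)) (m * om) _
    (le_trans z1 mo) (le_trans z2 mo).
    rewrite mulr_ge0 //=; last lra.
    by rewrite mulrC -ler_pdivlMr ?ltW //; lra.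
  rewrite -/(r w x) => r1 r2; have [h1 h2] := hA _ hx.
  rewrite (Re_mul (r w x)) (Im_mul (r w x)); split.
    by apply: le_trans (ler_normB _ _) _; apply: lerD; rewrite normrM ler_pM.
  by apply: le_trans (ler_normD _ _) _; apply: lerD; rewrite normrM ler_pM.
have [k1 k2] := iter_cint01_bound s (admissible_mul (ar w) ah) hb hx0.
apply: (@le_trans _ _ (c1%:C%C * (4 * (8 * (m * om) ^+ 2 * A))%:C%C)).
  apply: ler_wpM2l; first by rewrite ler0c.
  by apply: le_trans (normC_le_ReIm _) _; rewrite lecR; lra.
rewrite -omE -eE -!rmorphM lecR.
have -> : c1 * (4 * (8 * (m * om) ^+ 2 * A)) = (c1 * (32 * m ^+ 2 * A)) * om * om.
  by ring.
apply: ler_wpM2r => //; apply: (@le_trans _ _ (B * om)).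
  by apply: ler_wpM2r => //; rewrite lerDl.
by rewrite mulrC -ler_pdivlMr ?ltW //; lra.
Qed.
End Entire.

(** * Symbolic integration of piecewise polynomial exponentials *)

Section ComplexPrimitive.
Context {R : realType}.
Local Notation mu := (@lebesgue_measure R).

Definition cderive (f df : R -> R[i]) : Prop := forall u : R,
  is_derive u 1 (fun v => complex.Re (f v)) (complex.Re (df u)) /\
  is_derive u 1 (fun v => complex.Im (f v)) (complex.Im (df u)).

Lemma eq_cderive f g df dg : f =1 g -> df =1 dg -> cderive f df -> cderive g dg.
Proof. by move=> /funext <- /funext <-. Qed.

Lemma cderive_cst c : cderive (fun=> c) (fun=> 0).
Proof. by move=> u; split; apply: is_derive_cst. Qed.

Lemma cderive_affine p q : cderive (fun u => (p * u + q)%:C%C) (fun=> p%:C%C).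
Proof.
move=> u; split => /=; last exact: is_derive_cst.
have h := is_deriveD (is_deriveZ p (is_derive_id u 1)) (is_derive_cst q u 1).
by rewrite addr0 /GRing.scale /= mulr1 in h; exact: h.
Qed.

Lemma cderive_add f g df dg : cderive f df -> cderive g dg ->
  cderive (fun u => f u + g u) (fun u => df u + dg u).
Proof.
move=> hf hg u; have [f1 f2] := hf u; have [g1 g2] := hg u.
under eq_fun do rewrite Re_add; under [X in _ /\ is_derive _ _ X _]eq_fun do rewrite Im_add.
by rewrite Re_add Im_add; split; exact: is_deriveD.
Qed.

Lemma cderive_mul f g df dg : cderive f df -> cderive g dg ->
  cderive (fun u => f u * g u) (fun u => f u * dg u + df u * g u).
Proof.
move=> hf hg u; have [f1 f2] := hf u; have [g1 g2] := hg u.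
under eq_fun do rewrite Re_mul; under [X in _ /\ is_derive _ _ X _]eq_fun do rewrite Im_mul.
rewrite Re_add Im_add !Re_mul !Im_mul; split.
  apply: is_derive_eq (is_deriveB (is_deriveM f1 g1) (is_deriveM f2 g2)) _.
  by rewrite /GRing.scale /=; ring.
apply: is_derive_eq (is_deriveD (is_deriveM f1 g2) (is_deriveM f2 g1)) _.
by rewrite /GRing.scale /=; ring.
Qed.

Lemma cderive_cexp (a b : R[i]) :
  cderive (fun u => cexp (a * u%:C%C + b)) (fun u => a * cexp (a * u%:C%C + b)).
Proof.
case: a b => a1 a2 [b1 b2].
have dlin (p q u : R) : is_derive u 1 (fun v => p * v + q) p.
  by have [] := cderive_affine p q u.
move=> u; rewrite (Re_mul (a1 +i* a2)%C) (Im_mul (a1 +i* a2)%C).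
have E v : cexp ((a1 +i* a2)%C * v%:C%C + (b1 +i* b2)%C) =
   (expR (a1 * v + b1) * cos (a2 * v + b2) +i*
    (expR (a1 * v + b1) * sin (a2 * v + b2)))%C.
  by apply/eqP; rewrite eq_complex /cexp /= !mul0r !mulr0 !subr0 !addr0 !add0r !eqxx.
have d1 := @is_derive1_comp _ expR (fun v => a1 * v + b1) u _ _
    (is_derive_expR (a1 * u + b1)) (dlin a1 b1 u).
have d2 := @is_derive1_comp _ cos (fun v => a2 * v + b2) u _ _
    (is_derive_cos (a2 * u + b2)) (dlin a2 b2 u).
have d3 := @is_derive1_comp _ sin (fun v => a2 * v + b2) u _ _
    (is_derive_sin (a2 * u + b2)) (dlin a2 b2 u).
split.
  rewrite (_ : (fun v => _) = (expR \o (fun v => a1 * v + b1)) *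
      (cos \o (fun v => a2 * v + b2))); last by apply/funext => v; rewrite E.
  by apply: is_derive_eq (is_deriveM d1 d2) _; rewrite E /GRing.scale /=; ring.
rewrite (_ : (fun v => _) = (expR \o (fun v => a1 * v + b1)) *
      (sin \o (fun v => a2 * v + b2))); last by apply/funext => v; rewrite E.
by apply: is_derive_eq (is_deriveM d1 d3) _; rewrite E /GRing.scale /=; ring.
Qed.

Lemma Rintegral_unit_itv_FTC (F f df : R -> R) l r :
  (forall u : R, is_derive u 1 F (f u)) -> (forall u : R, is_derive u 1 f (df u)) ->
  0 <= l -> r <= 1 -> l <= r ->
  \int[mu]_(u in `[0, 1]) ((l <= u)%R%:R * (u <= r)%R%:R * f u) = F r - F l.
Proof.
move=> dF df' l0 r1 lr.
transitivity (\int[mu]_(u in `[l, r]) f u).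
  have -> : `[l, r]%classic = `[0%R, 1%R]%classic `&` `[l, r]%classic.
    apply/seteqP; split => u /=; rewrite !in_itv /=; last by case.
    by move=> /andP[lu ur]; rewrite lu ur (le_trans l0 lu) (le_trans ur r1).
  rewrite Rintegral_mkcondr; apply: eq_Rintegral => u _.
  rewrite patchE mem_setE in_itv /=.
  by case: (l <= u); case: (u <= r) => /=; rewrite ?mul1r ?mul0r.
have cont (g dg : R -> R) : (forall u : R, is_derive u 1 g (dg u)) -> continuous g.
  move=> hg u; apply: differentiable_continuous; apply/derivable1_diffP.
  by have [] := hg u.
(* A degenerate interval is treated apart, [continuous_FTC2] being stated for l < r. *)
move: lr; rewrite le_eqVlt => /predU1P[<-|lr].
  by rewrite subrr set_itv1 /Rintegral integral_set1.
rewrite /Rintegral (@continuous_FTC2 _ f F) //.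
- by apply: continuous_subspaceT; exact: cont df'.
- split => [u _||]; first by have [] := dF u.
    by apply: cvg_at_right_filter; exact: cont dF _.
  by apply: cvg_at_left_filter; exact: cont dF _.
- by move=> u _; rewrite derive1E; have [_ ->] := dF u.
Qed.

(** The bounds will depend on the other variables, so l <= r is not known in advance. When it fails
    the two indicators exclude each other, whence the factor in front; it later becomes a constraint
    on the other variables. The derivative [df] supplies the continuity of [f]. *)
Lemma cint01_FTC (F f df : R -> R[i]) l r : cderive F f -> cderive f df ->
  0 <= l -> r <= 1 ->
  cint01 (fun u => ((l <= u)%R%:R * (u <= r)%R%:R)%:C%C * f u) =
  ((l <= r)%R%:R)%:C%C * (F r - F l).
Proof.
move=> dF df' l0 r1; have [lr|rl] := leP l r; last first.
  rewrite mul0r (_ : (fun u => _) = fun=> 0); last first.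
    apply/funext => u; have [lu|] := leP l u; last by rewrite mul0r mul0r.
    by rewrite [u <= r]leNgt (lt_le_trans rl lu) mulr0 mul0r.
  rewrite /cint01 /Rintegral /=.
  by rewrite integral0_eq //.
rewrite mul1r /cint01.
under eq_Rintegral do rewrite Re_mul /= mul0r subr0.
under [in X in (_ +i* X)%C]eq_Rintegral do rewrite Im_mul /= mul0r addr0.
rewrite (@Rintegral_unit_itv_FTC _ _ _ l r
  (fun u => (dF u).1) (fun u => (df' u).1) l0 r1 lr).
rewrite (@Rintegral_unit_itv_FTC _ _ _ l r
  (fun u => (dF u).2) (fun u => (df' u).2) l0 r1 lr).
by case: (F r) => ? ?; case: (F l).
Qed.
End ComplexPrimitive.

(** * Affine forms, and primitives of polynomials times an exponential *)

Section AffineForms.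
Context {R : realType} {E : finType}.
Implicit Types (x : E -> R) (t g : E).

Let ratrM (p q : rat) : ratr (p * q) = ratr p * ratr q :> R.
Proof. exact: rmorphM. Qed.

Let RtoCM (a b : R) : (a * b)%:C%C = a%:C%C * b%:C%C.
Proof. exact: rmorphM. Qed.

(** Rational slopes allow a sign test and a clearing of denominators independent of [y]; the real
    constant term is the only place for [y]. *)
Definition aform : Type := ({ffun E -> rat} * R)%type.

Implicit Types a b : aform.

Definition aeval (a : aform) x : R := \sum_g ratr (a.1 g) * x g + a.2.

Definition aprod (L : seq aform) x : R := \prod_(a <- L) aeval a x.

Definition aconst (c : R) : aform := ([ffun=> 0], c).

Definition adiff (a b : aform) : aform := ([ffun g => a.1 g - b.1 g], a.2 - b.2).

Definition asubst t (b a : aform) : aform :=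
  ([ffun g => (if g == t then 0 else a.1 g) + a.1 t * b.1 g],
   a.2 + ratr (a.1 t) * b.2).

(** the value of [x t] at which [a] vanishes, as a form in the other
  coordinates; meaningful when [a.1 t != 0] *)
Definition aroot t (a : aform) : aform :=
  ([ffun g => if g == t then 0 else - (a.1 g / a.1 t)], - (a.2 / ratr (a.1 t))).

Lemma aeval_const c x : aeval (aconst c) x = c.
Proof. by rewrite /aeval big1 ?add0r // => g _; rewrite ffunE rmorph0 mul0r. Qed.

Lemma aeval_diff a b x : aeval (adiff a b) x = aeval a x - aeval b x.
Proof.
rewrite /aeval /= opprD addrACA -sumrB; congr (_ + _); apply: eq_bigr => g _.
by rewrite ffunE rmorphB mulrBl.
Qed.

Lemma aeval_with a x t u : aeval a [eta x with t |-> u] =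
  ratr (a.1 t) * u + (\sum_(g | g != t) ratr (a.1 g) * x g + a.2).
Proof.
rewrite /aeval (bigD1 t) //= eqxx addrA; congr (_ + _ + _).
by apply: eq_bigr => g /negPf ->.
Qed.

Lemma aeval_subst t b a x :
  aeval (asubst t b a) x = aeval a [eta x with t |-> aeval b x].
Proof.
rewrite aeval_with /aeval /= [X in _ = _ + (X + _)]big_mkcond mulrDr mulr_sumr /=.
rewrite (eq_bigr (fun g => ratr (a.1 t) * (ratr (b.1 g) * x g) +
  (if g != t then ratr (a.1 g) * x g else 0))).
  by rewrite big_split /=; ring.
move=> g _; rewrite ffunE rmorphD rmorphM /=.
by case: (g == t); rewrite /= ?rmorph0; ring.
Qed.

Lemma aeval_without t a x u : a.1 t = 0 -> aeval a [eta x with t |-> u] = aeval a x.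
Proof.
move=> a0; rewrite aeval_with a0 rmorph0 mul0r add0r /aeval [in RHS](bigD1 t) //=.
by rewrite a0 rmorph0 mul0r add0r.
Qed.

Lemma aeval_root t a x u : a.1 t != 0 ->
  aeval a [eta x with t |-> u] = ratr (a.1 t) * (u - aeval (aroot t a) x).
Proof.
move=> a0; have r0 : (ratr (a.1 t) : R) != 0 by rewrite fmorph_eq0.
rewrite aeval_with mulrBr; congr (_ + _).
rewrite /aeval /= mulrDr opprD mulrN opprK mulrCA mulfV // mulr1; congr (_ + _).
rewrite mulr_sumr -sumrN [LHS]big_mkcond; apply: eq_bigr => g _.
rewrite ffunE; case: (g == t) => /=; first by rewrite rmorph0 mul0r mulr0 oppr0.
by rewrite rmorphN fmorph_div; field.
Qed.

Lemma aprod_cons a L x : aprod (a :: L) x = aeval a x * aprod L x.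
Proof. exact: big_cons. Qed.

Lemma aprod_subst t b L x :
  aprod (map (asubst t b) L) x = aprod L [eta x with t |-> aeval b x].
Proof. by rewrite /aprod big_map; apply: eq_bigr => a _; exact: aeval_subst. Qed.

Lemma admissible_aeval a : admissible (fun x => (aeval a x)%:C%C).
Proof.
under eq_fun do rewrite /aeval rmorphD rmorph_sum /=.
apply: admissible_add; last exact: admissible_cst.
apply: admissible_sum => g; under eq_fun do rewrite rmorphM /=.
apply: admissible_mul; [exact: admissible_cst|exact: admissible_coord].
Qed.

Lemma admissible_aprod L : admissible (fun x => (aprod L x)%:C%C).
Proof.
under eq_fun do rewrite /aprod rmorph_prod /=.
by apply: admissible_prod => a; exact: admissible_aeval.
Qed.

(** [(q, L, j)] encodes the summand [q * aprod L / cc ^+ j], [cc] being the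
  logarithmic derivative of the exponential factor. *)
Definition pterm : Type := (rat * seq aform * nat)%type.

Definition peval (s : seq pterm) (cc : R[i]) x : R[i] :=
  \sum_(q <- s) (ratr q.1.1 * aprod q.1.2 x)%:C%C / cc ^+ q.2.

Lemma peval1 q cc x :
  peval [:: q] cc x = (ratr q.1.1 * aprod q.1.2 x)%:C%C / cc ^+ q.2.
Proof. exact: big_seq1. Qed.

Lemma peval_cat s1 s2 cc x : peval (s1 ++ s2) cc x = peval s1 cc x + peval s2 cc x.
Proof. exact: big_cat. Qed.

Lemma peval_mul a s cc x :
  peval [seq (q.1.1, a :: q.1.2, q.2) | q <- s] cc x = (aeval a x)%:C%C * peval s cc x.
Proof.
rewrite /peval big_map mulr_sumr; apply: eq_bigr => q _ /=.
by rewrite aprod_cons !RtoCM; ring.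
Qed.

Lemma peval_scale r s cc x :
  peval [seq (r * q.1.1, q.1.2, q.2) | q <- s] cc x = (ratr r)%:C%C * peval s cc x.
Proof.
rewrite /peval big_map mulr_sumr; apply: eq_bigr => q _ /=.
by rewrite ratrM !RtoCM; ring.
Qed.

(** [n] bounds the degree, [b] the degree plus the number of divisions, and [c] bounds the number of
    divisions from below. Inclusion in [L0] lets properties of the original factors pass to the
    primitive. *)
Definition pbounded (L0 : seq aform) (n b c : nat) (s : seq pterm) : Prop :=
  forall q, q \in s -> [/\ {subset q.1.2 <= L0}, (size q.1.2 <= n)%N,
    (size q.1.2 + q.2 <= b)%N & (c <= q.2)%N].

(** [s'] is fixed before [x], [cc] and [e], because [cc] will be a linear form in [z] whereas the
    final list of terms must not depend on [z]. Of the exponential only e' = cc e matters. *)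
Definition is_primitive t (s' s : seq pterm) : Prop :=
  forall x (cc : R[i]) (e : R -> R[i]), cc != 0 ->
    cderive e (fun u => cc * e u) ->
    cderive (fun u => peval s' cc [eta x with t |-> u] * e u)
            (fun u => peval s cc [eta x with t |-> u] * e u).

Lemma pbounded_cat L0 (n b c : nat) s1 s2 : pbounded L0 n b c s1 -> pbounded L0 n b c s2 ->
  pbounded L0 n b c (s1 ++ s2).
Proof. by move=> h1 h2 q; rewrite mem_cat => /orP[/h1|/h2]. Qed.

Lemma is_primitive_cat t s1' s1 s2' s2 : is_primitive t s1' s1 ->
  is_primitive t s2' s2 -> is_primitive t (s1' ++ s2') (s1 ++ s2).
Proof.
move=> h1 h2 x cc e cc0 he.
apply: eq_cderive (cderive_add (h1 x cc e cc0 he) (h2 x cc e cc0 he)) => u;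
  by rewrite peval_cat mulrDl.
Qed.

(* Integration by parts: if [A e] is a primitive of [P e], then
  [a A e - (da/du) (primitive of A e)] is one of [a P e]. *)
Lemma pterm_primitive t L0 (n b c : nat) s : pbounded L0 n b c s ->
  exists2 s', pbounded L0 n b.+1 c.+1 s' & is_primitive t s' s.
Proof.
elim: n b c s => [|n IHn] b c; (elim=> [|[[r L] j] s IHs] hs;
  [exists [::] => // x cc e _ _;
   by apply: eq_cderive (cderive_cst _) => u; rewrite /peval big_nil mul0r|]).
- have [|s' bs' ps'] := IHs; first by move=> q qs; apply: hs; rewrite inE qs orbT.
  have [/= _ + Lb cj] := hs _ (mem_head _ _); rewrite leqn0 => /nilP L0E.
  exists ([:: (r, L, j.+1)] ++ s'); last first.
    rewrite -[_ :: s]cat1s; apply: is_primitive_cat => // x cc e cc0 he.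
    apply: eq_cderive (cderive_mul (cderive_cst ((ratr r)%:C%C / cc ^+ j.+1)) he) => u;
      rewrite /peval big_seq1 /= L0E /aprod big_nil mulr1 //.
    by rewrite mul0r addr0 mulrA exprS invfM; congr (_ * _); field; rewrite cc0 expf_neq0.
  apply: pbounded_cat => // q; rewrite inE => /eqP -> /=; rewrite L0E /=.
  by move: Lb; rewrite L0E /= add0n.
- have [|s' bs' ps'] := IHs; first by move=> q qs; apply: hs; rewrite inE qs orbT.
  have [/= sL sn Lb cj] := hs _ (mem_head _ _).
  suff [s1 b1 p1] : exists2 s1, pbounded L0 n.+1 b.+1 c.+1 s1 &
      is_primitive t s1 [:: (r, L, j)].
    exists (s1 ++ s'); first exact: pbounded_cat.
    by rewrite -[_ :: s]cat1s; exact: is_primitive_cat.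
  case: L sL sn Lb {hs} => [|a L] sL sn Lb.
    have [|s1 b1 p1] := IHn b c [:: (r, [::], j)].
      by move=> q; rewrite inE => /eqP ->.
    exists s1 => // q /b1[? ? ? ?]; split => //; exact: leqW.
  (* Removing the factor [a] lowers the total bound to [b.-1]; the primitive brings it back to [b],
     which leaves room for [a] within [b.+1]. *)
  have [|sA bA pA] := IHn b.-1 c [:: (r, L, j)].
    move=> q; rewrite inE => /eqP -> /=; split => //.
      by move=> z zL; apply: sL; rewrite inE zL orbT.
    by move: Lb; rewrite /= addSn; case: (b).
  have bpos : (0 < b)%N by apply: leq_trans Lb.
  rewrite prednK // in bA.
  (* The correction term of the integration by parts: [a.1 t] is the derivative of [a] in x_t, and
     [sA] already carries [c.+1] divisions. *)
  have [|sB bB pB] := IHn b c.+1 [seq (- a.1 t * q.1.1, q.1.2, q.2) | q <- sA].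
    by move=> q /mapP[q' /bA[? ? ? ?] ->].
  exists ([seq (q.1.1, a :: q.1.2, q.2) | q <- sA] ++ sB).
    apply: pbounded_cat; last first.
      by move=> q /bB[? ? ? ?]; split => //; [exact: leqW|exact: ltnW].
    move=> q /mapP[q' /bA[h1 h2 h3 h4] ->] /=; split => //.
      by move=> z; rewrite inE => /orP[/eqP ->|/h1 //]; apply: sL; rewrite mem_head.
  move=> x cc e cc0 he.
  have da := cderive_affine (ratr (a.1 t)) (\sum_(g | g != t) ratr (a.1 g) * x g + a.2).
  apply: eq_cderive (cderive_add (cderive_mul da (pA x cc e cc0 he)) (pB x cc e cc0 he)).
    by move=> u; rewrite peval_cat peval_mul aeval_with mulrDl mulrA.
  move=> u; rewrite -aeval_with peval_scale.
  rewrite !peval1 /= aprod_cons (rmorphN (@ratr R)) /=.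
  move: (ratr r) (ratr (a.1 t)) => r1 r2.
  by rewrite !RtoCM (rmorphN (real_complex R)) /=; ring.
Qed.
End AffineForms.

(** * Coefficients depending on y, and the encoded terms *)

Section Terms.
Context {R : realType} {r : nat} (J : {set 'I_r}) (yc : 'I_r -> R).

Lemma QAy_rat q : QAy J yc (ratr q).
Proof.
exists (fun=> 0), q; rewrite big1 ?add0r // => i _.
by rewrite rmorph0 mul0r.
Qed.

Lemma QAy_add a b : QAy J yc a -> QAy J yc b -> QAy J yc (a + b).
Proof.
move=> [c [d ->]] [c' [d' ->]]; exists (fun i => c i + c' i), (d + d').
rewrite rmorphD /= addrACA -big_split; congr (_ + _); apply: eq_bigr => i _.
by rewrite rmorphD mulrDl.
Qed.

Lemma QAy_scale q a : QAy J yc a -> QAy J yc (ratr q * a).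
Proof.
move=> [c [d ->]]; exists (fun i => q * c i), (q * d).
rewrite mulrDr mulr_sumr (rmorphM (@ratr R)); congr (_ + _); apply: eq_bigr => i _.
by rewrite (rmorphM (@ratr R)) /= mulrA.
Qed.

Lemma QAy_opp a : QAy J yc a -> QAy J yc (- a).
Proof.
move=> h; rewrite -mulN1r (_ : -1 = ratr (-1)); first exact: QAy_scale.
by rewrite (rmorphN (@ratr R)) /= (rmorph1 (@ratr R)).
Qed.

Lemma QAy_coord i : i \in J -> QAy J yc (yc i).
Proof.
move=> iJ; exists (fun j => (j == i)%:R), 0; rewrite (rmorph0 (@ratr R)) addr0.
rewrite (bigD1 i) //= eqxx (rmorph1 (@ratr R)) mul1r big1 ?addr0 // => j /andP[_ /negPf ->].
by rewrite (rmorph0 (@ratr R)) mul0r.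
Qed.

Lemma Qy_mul a b : Qy J yc a -> Qy J yc b -> Qy J yc (a * b).
Proof.
move=> [s ->] [s' ->].
exists [seq (t.1 * t'.1, fun i => (t.2 i + t'.2 i)%N) | t <- s, t' <- s'].
rewrite big_allpairs_dep mulr_suml; apply: eq_bigr => t _.
rewrite mulr_sumr; apply: eq_bigr => t' _ /=.
rewrite (rmorphM (@ratr R)) /= mulrACA -big_split; congr (_ * _).
by apply: eq_bigr => i _; rewrite exprD.
Qed.

Lemma Qy_QAy a : QAy J yc a -> Qy J yc a.
Proof.
move=> [c [d ->]].
exists ((d, fun=> 0%N) :: [seq (c i, fun j => nat_of_bool (j == i)) | i <- enum J]).
rewrite big_cons big_map big_enum /= addrC; congr (_ + _).
  by rewrite big1 ?mulr1 // => i _; rewrite expr0.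
apply: eq_bigr => i iJ; congr (_ * _).
rewrite (bigD1 i) //= eqxx expr1 big1 ?mulr1 // => j /andP[_ /negPf ->].
by rewrite expr0.
Qed.

Lemma Qy_rat q : Qy J yc (ratr q).
Proof. exact/Qy_QAy/QAy_rat. Qed.

Context {E : finType}.
Implicit Types (x : E -> R) (t g : E) (z : 'rV[R[i]]_#|E|).

Definition awf (a : @aform R E) : Prop := QAy J yc a.2.

Lemma awf_const q : awf (aconst (ratr q)). Proof. exact: QAy_rat. Qed.

Lemma awf_diff a b : awf a -> awf b -> awf (adiff a b).
Proof. by move=> ha hb; apply: QAy_add => //; exact: QAy_opp. Qed.

Lemma awf_subst t b a : awf b -> awf a -> awf (asubst t b a).
Proof. by move=> hb ha; apply: QAy_add => //; exact: QAy_scale. Qed.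

Lemma awf_root t a : awf a -> awf (aroot t a).
Proof.
by move=> ha; apply: QAy_opp; rewrite mulrC -(fmorphV (@ratr R)); exact: QAy_scale.
Qed.

(** [(p, L, psi, H, D)] encodes the function
  [p * \prod_(a in L) a(x) * 1_(h(x) >= 0 for all h in H)
     * exp (pi i \sum_g z_g psi_g(x)) / \prod_(d in D) (pi i \sum_g d_g z_g)]. *)
Definition term : Type :=
  (R * seq (@aform R E) * {ffun E -> @aform R E} * seq (@aform R E)
   * seq {ffun E -> int})%type.

Definition hprod (H : seq (@aform R E)) x : R := \prod_(h <- H) (0 <= aeval h x)%R%:R.

Definition dform (d : {ffun E -> int}) z : R[i] := zform (fun g => (d g)%:~R) z.

Definition dprod (D : seq {ffun E -> int}) z : R[i] :=
  \prod_(d <- D) (pii R * dform d z).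

Definition texp (psi : {ffun E -> @aform R E}) z x : R[i] :=
  cexp (pii R * zform (fun g => aeval (psi g) x) z).

Definition teval z (tau : term) x : R[i] :=
  let: (p, L, psi, H, D) := tau in
  (p * aprod L x * hprod H x)%:C%C * texp psi z x / dprod D z.

Definition nondeg z (tau : term) : Prop := forall d, d \in tau.2 -> dform d z != 0.

(** The form [- 2 x_g] multiplying [pi i z_g] in the initial exponent.  Integrating
  another variable does not change [psi g], so that the exponent still depends
  on [x g] through a nonzero form in [z] when [g] is integrated. *)
Definition psi0 g : @aform R E := ([ffun h => if h == g then -2 else 0], 0).

(** [S] holds the variables still to be integrated. [b] bounds affine factors plus denominators and
    [c] bounds the denominators from below; each integration raises both by one. *)
Definition twf (S : pred E) (b c : nat) (tau : term) : Prop :=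
  let: (p, L, psi, H, D) := tau in
  [/\ Qy J yc p, forall a, a \in L -> awf a, forall g, awf (psi g)
    & forall h, h \in H -> awf h] /\
  [/\ forall d, d \in D -> exists g, d g != 0, forall g, S g -> psi g = psi0 g,
      (size L + size D <= b)%N & (c <= size D)%N].

Definition tneg (tau : term) : term :=
  let: (p, L, psi, H, D) := tau in (- p, L, psi, H, D).

Lemma teval_neg z tau x : teval z (tneg tau) x = - teval z tau x.
Proof.
case: tau => [[[[p L] psi] H] D] /=.
by rewrite !mulNr (rmorphN (real_complex R)) !mulNr.
Qed.

Lemma twf_neg S b c tau : twf S b c tau -> twf S b c (tneg tau).
Proof.
case: tau => [[[[p L] psi] H] D] /= [[h1 h2 h3 h4] h5]; split => //; split => //.
rewrite -mulN1r (_ : -1 = ratr (-1)); first by apply: Qy_mul => //; exact: Qy_rat.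
by rewrite (rmorphN (@ratr R)) /= (rmorph1 (@ratr R)).
Qed.

Lemma admissible_hprod H : admissible (fun x => (hprod H x)%:C%C).
Proof.
under eq_fun do rewrite /hprod rmorph_prod /=.
by apply: admissible_prod => h; apply: admissible_ge0; exact: admissible_aeval.
Qed.

Lemma admissible_teval z tau : admissible (teval z tau).
Proof.
case: tau => [[[[p L] psi] H] D]; rewrite /teval.
apply: admissible_mul; last exact: admissible_cst.
apply: admissible_mul.
  under eq_fun do rewrite !(rmorphM (real_complex R)) /=.
  apply: admissible_mul; last exact: admissible_hprod.
  apply: admissible_mul; [exact: admissible_cst|exact: admissible_aprod].
apply: admissible_cexp; apply: admissible_mul; first exact: admissible_cst.
apply: admissible_sum => g; apply: admissible_mul; last exact: admissible_cst.
exact: admissible_aeval.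
Qed.

Lemma hprod_cons h H x : hprod (h :: H) x = (0 <= aeval h x)%R%:R * hprod H x.
Proof. exact: big_cons. Qed.

Lemma dprod_cat D1 D2 z : dprod (D1 ++ D2) z = dprod D1 z * dprod D2 z.
Proof. exact: big_cat. Qed.

Lemma dprod_nseq j d z : dprod (nseq j d) z = (pii R * dform d z) ^+ j.
Proof. by rewrite /dprod big_nseq iter_mulr_1. Qed.

Lemma texp_subst (psi : {ffun E -> @aform R E}) t b z x :
  texp [ffun g => asubst t b (psi g)] z x = texp psi z [eta x with t |-> aeval b x].
Proof.
rewrite /texp; congr (cexp (_ * _)); apply: eq_bigr => g _.
by rewrite ffunE aeval_subst.
Qed.

Lemma texp_with (psi : {ffun E -> @aform R E}) t z x : exists b, forall u, texp psi z [eta x with t |-> u] =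
  cexp ((pii R * zform (fun g => ratr ((psi g).1 t)) z) * u%:C%C + b).
Proof.
exists (pii R * zform (fun g => \sum_(h | h != t) ratr ((psi g).1 h) * x h + (psi g).2) z).
move=> u; rewrite /texp -mulrA -mulrDr; congr (cexp (_ * _)).
rewrite mulr_suml -big_split; apply: eq_bigr => g _ /=.
rewrite aeval_with (rmorphD (real_complex R)) /= mulrDl; congr (_ + _).
by rewrite (rmorphM (real_complex R)) /= -!mulrA [_ * u%:C%C]mulrC.
Qed.

Lemma clear_denominators (q : E -> rat) : exists (m : rat) (d : {ffun E -> int}),
  m != 0 /\ forall g, (d g)%:~R = m * q g.
Proof.
exists (\prod_g (denq (q g))%:~R), [ffun g => numq (q g) * \prod_(h | h != g) denq (q h)].
split; first by apply/prodf_neq0 => g _; rewrite intr_eq0 denq_eq0.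
move=> g; rewrite ffunE [in RHS](bigD1 g) //= rmorphM rmorph_prod /= mulrAC; congr (_ * _).
by rewrite numqE mulrC.
Qed.
End Terms.

(** * Integration of encoded terms, one variable after another *)

Section SymbolicIntegration.
Context {R : realType} {r : nat} (J : {set 'I_r}) (yc : 'I_r -> R) {E : finType}.
Implicit Types (x : E -> R) (t g : E) (z : 'rV[R[i]]_#|E|).
Local Notation twf := (@twf R r J yc E).
Local Notation awf := (@awf R r J yc E).

Lemma RtoC_neq0 (a : R) : (a%:C%C != 0) = (a != 0).
Proof. by rewrite eq_complex /= eqxx andbT. Qed.

Lemma pii_neq0 : pii R != 0.
Proof. by rewrite /pii mulf_neq0 ?neq0Ci // RtoC_neq0 gt_eqF ?pi_gt0. Qed.

Lemma cint01_0 : cint01 (fun=> 0) = 0 :> R[i].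
Proof. by rewrite /cint01 /Rintegral /= integral0_eq. Qed.

Lemma aprod_cderive L t x :
  exists df, cderive (fun u => (aprod L [eta x with t |-> u])%:C%C) df.
Proof.
elim: L => [|a L [df hdf]].
  exists (fun=> 0); apply: eq_cderive (cderive_cst 1) => // u.
  by rewrite /aprod big_nil.
have da := cderive_affine (ratr (a.1 t)) (\sum_(g | g != t) ratr (a.1 g) * x g + a.2).
eexists; apply: eq_cderive (cderive_mul da hdf) => [u|//].
by rewrite aprod_cons -aeval_with (rmorphM (real_complex R)).
Qed.

(** [H] holds the constraints not yet converted into the bounds [l] and [rr] on x_t. *)
Definition integrand p L psi D z t x (l rr : R) H u : R[i] :=
  ((l <= u)%R%:R * (u <= rr)%R%:R)%:C%C *
  ((p * aprod L [eta x with t |-> u] * hprod H [eta x with t |-> u])%:C%C *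
   texp psi z [eta x with t |-> u] / dprod D z).

Section OneVariable.
Variables (t : E) (S : pred E) (b c : nat).
Variables (p : R) (L : seq (@aform R E)) (psi : {ffun E -> @aform R E})
  (D : seq {ffun E -> int}) (m : rat) (d : {ffun E -> int}).
Hypotheses (hp : Qy J yc p) (hL : forall a, a \in L -> awf a)
  (hpsi : forall g, awf (psi g)) (hD : forall e, e \in D -> exists g, e g != 0)
  (hS : forall g, S g -> psi g = psi0 g) (hb : (size L + size D <= b)%N)
  (hc : (c <= size D)%N) (St : S t)
  (m0 : m != 0) (hd : forall g, (d g)%:~R = m * (psi g).1 t).

Let S' : pred E := fun g => S g && (g != t).

Lemma psi_asubst a g : S' g -> [ffun g => asubst t a (psi g)] g = psi0 g.
Proof.
move=> /andP[Sg gt]; rewrite ffunE hS // /asubst /psi0 /= !ffunE eq_sym (negPf gt).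
rewrite (rmorph0 (@ratr R)) mul0r addr0; congr (_, _); apply/ffunP => h.
by rewrite !ffunE mul0r addr0; case: eqP => // ->; rewrite eq_sym (negPf gt).
Qed.

(** For the new form [d] the witness is [t] itself: psi_t is still -2 x_t, so d_t = -2 m. *)
Lemma den_neq0 e j : e \in D ++ nseq j d -> exists g, e g != 0.
Proof.
rewrite mem_cat => /orP[/hD //|]; rewrite mem_nseq => /andP[_ /eqP ->].
exists t; rewrite -(intr_eq0 rat) hd mulf_neq0 // hS // ffunE eqxx.
by rewrite oppr_eq0.
Qed.

(** With no constraint left, the integral is the difference of a primitive at the two endpoints.
    [Hd] collects the constraints free of x_t that were met on the way; they ensure that the bounds
    lie within [0, 1]. *)
Lemma integrand_interval l rr Hd : awf l -> awf rr -> (forall h, h \in Hd -> awf h) ->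
  exists2 s : seq (@term R E), (forall tau, tau \in s -> twf S' b.+1 c.+1 tau) &
  forall z, dform d z != 0 -> forall x,
    (hprod Hd x != 0 -> 0 <= aeval l x /\ aeval rr x <= 1) ->
    (hprod Hd x)%:C%C * cint01 (integrand p L psi D z t x (aeval l x) (aeval rr x) [::])
    = \sum_(tau <- s) teval z tau x.
Proof.
move=> hl hr hHd.
have [|sP bP pP] := @pterm_primitive R E t L (size L) (size L) 0 [:: (1, L, 0%N)].
  by move=> q; rewrite inE => /eqP ->; split; rewrite /= ?addn0.
(* The value of one term of the primitive at x_t = e(x). The power of [m] compensates for dividing
   by pi i times [dform d], which is [m * cc], instead of [cc]; [adiff rr l] encodes the factor 1_(l
   <= rr). *)
pose new (e : @aform R E) (q : @pterm R E) : @term R E :=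
  (p * ratr (q.1.1 * m ^+ q.2), map (asubst t e) q.1.2,
   [ffun g => asubst t e (psi g)], adiff rr l :: Hd, D ++ nseq q.2 d).
have new_wf e q : awf e -> q \in sP -> twf S' b.+1 c.+1 (new e q).
  move=> he /bP[h1 h2 h3 h4]; split; split.
  - by apply: Qy_mul => //; exact: Qy_rat.
  - by move=> a /mapP[a' /h1 /hL a'L ->]; exact: awf_subst.
  - by move=> g; rewrite ffunE; exact: awf_subst.
  - by move=> h; rewrite inE => /orP[/eqP ->|/hHd //]; exact: awf_diff.
  - by move=> ? /den_neq0.
  - exact: psi_asubst.
  - rewrite size_map size_cat size_nseq addnCA.
    apply: leq_trans (leq_add (leqnn _) h3) _.
    by rewrite addnS ltnS addnC.
  - by rewrite size_cat size_nseq -addn1 leq_add.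
exists (map (new rr) sP ++ map (@tneg R E) (map (new l) sP)).
  move=> tau; rewrite mem_cat => /orP[/mapP[q qs ->]|/mapP[tau' /mapP[q qs ->] ->]].
    exact: new_wf.
  by apply: twf_neg; exact: new_wf.
move=> z dz x hx; have [w ew] := texp_with psi t z x.
set cc := pii R * zform (fun g => ratr ((psi g).1 t)) z in ew.
have pii0 : pii R != 0.
  exact: pii_neq0.
have dE : pii R * dform d z = (ratr m)%:C%C * cc.
  rewrite /cc mulrCA; congr (_ * _); rewrite /dform /zform mulr_sumr.
  apply: eq_bigr => g _; rewrite mulrA -(rmorphM (real_complex R)) /= -(rmorphM (@ratr R)) /=.
  by rewrite -hd ratr_int.
have mC : (ratr m : R)%:C%C != 0.
  by rewrite RtoC_neq0 fmorph_eq0.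
have cc0 : cc != 0.
  have : pii R * dform d z != 0 by rewrite mulf_neq0.
  by rewrite dE mulf_eq0 negb_or => /andP[].
have newE e q : teval z (new e q) x =
    (p%:C%C / dprod D z) * ((ratr q.1.1 * aprod q.1.2 [eta x with t |-> aeval e x])%:C%C
      / cc ^+ q.2) * texp psi z [eta x with t |-> aeval e x]
     * (hprod (adiff rr l :: Hd) x)%:C%C.
  rewrite /new /teval aprod_subst texp_subst dprod_cat dprod_nseq dE.
  have -> : ratr (q.1.1 * m ^+ q.2) = ratr q.1.1 * (ratr m) ^+ q.2 :> R.
    by rewrite (rmorphM (@ratr R)) (rmorphXn (@ratr R)).
  move: (ratr m) mC (ratr q.1.1) (aprod _ _) (hprod _ _) (texp _ _ _) (dprod _ _).
  move=> m' m'0 r1 A h e1 D1.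
  rewrite !(rmorphM (real_complex R)) (rmorphXn (real_complex R)) /= exprMn !invfM.
  have mj : m'%:C%C ^+ q.2 != 0 by rewrite expf_neq0.
  move: (m'%:C%C ^+ q.2) mj (cc ^- q.2) (D1^-1) => M M0 ci Di.
  by field.
rewrite big_cat !big_map -[RHS]/(_ + _).
under [X in _ + X]eq_bigr do rewrite teval_neg newE.
under eq_bigr do rewrite newE.
rewrite sumrN -!mulr_suml -!mulr_sumr -/(peval sP cc _) -/(peval sP cc _).
(* Where [Hd] fails both sides vanish, and nothing is known about the bounds there. *)
have [H0|H0] := eqVneq (hprod Hd x) 0.
  by rewrite hprod_cons H0 mulr0 mul0r !mulr0 subr0.
have [l0 r1] := hx H0.
have he : cderive (fun u => texp psi z [eta x with t |-> u])
    (fun u => cc * texp psi z [eta x with t |-> u]).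
  by apply: eq_cderive (cderive_cexp cc w) => u; rewrite ew.
have [dL hdL] := aprod_cderive L t x.
pose k := p%:C%C / dprod D z.
have F1 := cderive_mul (cderive_cst k) (pP x cc _ cc0 he).
have F2 := cderive_mul (cderive_cst k) (cderive_mul hdL he).
have F1' : cderive (fun u => k * (peval sP cc [eta x with t |-> u] *
      texp psi z [eta x with t |-> u]))
    (fun u => k * ((aprod L [eta x with t |-> u])%:C%C *
      texp psi z [eta x with t |-> u])).
  apply: eq_cderive F1 => // u.
  by rewrite peval1 /= (rmorph1 (@ratr R)) mul1r expr0 divr1 mul0r addr0.
have := cint01_FTC F1' F2 l0 r1.
rewrite (_ : (fun u => _) = integrand p L psi D z t x (aeval l x) (aeval rr x) [::]); last first.
  apply/funext => u; rewrite /integrand /hprod big_nil mulr1 /k.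
  by rewrite !(rmorphM (real_complex R)) /=; ring.
move=> ->; rewrite hprod_cons aeval_diff subr_ge0 (rmorphM (real_complex R)) /=.
by rewrite /k; ring.
Qed.

Lemma integrand_cons z x l rr h H u :
  integrand p L psi D z t x l rr (h :: H) u =
  ((0 <= aeval h [eta x with t |-> u])%R%:R)%:C%C * integrand p L psi D z t x l rr H u.
Proof.
rewrite /integrand hprod_cons !(rmorphM (real_complex R)) /=.
by move: (_%:C%C) (_%:C%C) (_%:C%C) => *; ring.
Qed.

(* With a single further bound [a], [1_(l <= u) 1_(a <= u)] is [1_(a <= u)] if
  [l <= a] and [1_(l <= u)] otherwise; the second case is written as
  [1 - 1_(l <= a)], so that only non-strict constraints occur. *)
Lemma integrand_constraints H : (forall h, h \in H -> awf h) ->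
  forall l rr Hd, awf l -> awf rr -> (forall h, h \in Hd -> awf h) ->
  exists2 s : seq (@term R E), (forall tau, tau \in s -> twf S' b.+1 c.+1 tau) &
  forall z, dform d z != 0 -> forall x,
    (hprod Hd x != 0 -> 0 <= aeval l x /\ aeval rr x <= 1) ->
    (hprod Hd x)%:C%C * cint01 (integrand p L psi D z t x (aeval l x) (aeval rr x) H)
    = \sum_(tau <- s) teval z tau x.
Proof.
elim: H => [|h H IH] hH l rr Hd wl wr wHd; first exact: integrand_interval.
have {}IH := IH (fun h' h'H => hH h' (mem_behead (s := h :: H) h'H)).
have wh : awf h by apply: hH; rewrite mem_head.
have wcons e : awf e -> forall h', h' \in e :: Hd -> awf h'.
  by move=> we h'; rewrite inE => /orP[/eqP -> //|/wHd].
have cat3 s1 s2 s3 : (forall tau, tau \in s1 -> twf S' b.+1 c.+1 tau) ->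
    (forall tau, tau \in s2 -> twf S' b.+1 c.+1 tau) ->
    (forall tau, tau \in s3 -> twf S' b.+1 c.+1 tau) ->
    (forall tau, tau \in s1 ++ s2 ++ map (@tneg R E) s3 -> twf S' b.+1 c.+1 tau).
  move=> h1 h2 h3 tau; rewrite !mem_cat => /or3P[/h1|/h2|] //.
  by move=> /mapP[tau' /h3 ? ->]; exact: twf_neg.
have sum3 (s1 s2 s3 : seq (@term R E)) z x :
    \sum_(tau <- s1 ++ s2 ++ map (@tneg R E) s3) teval z tau x =
    \sum_(tau <- s1) teval z tau x + \sum_(tau <- s2) teval z tau x
      - \sum_(tau <- s3) teval z tau x.
  rewrite !big_cat big_map -[LHS]/(_ + (_ + _)) addrA; congr (_ + _).
  by rewrite -sumrN; apply: eq_bigr => tau _; rewrite teval_neg.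
(* Negative slope: h >= 0 is an upper bound on x_t. Positive slope: a lower bound. Zero slope: the
   constraint does not involve x_t and joins [Hd]. *)
have [q0|q0|q0] := ltgtP (h.1 t) 0.
- have qlt : (ratr (h.1 t) : R) < 0 by rewrite ltrq0.
  pose a := aroot t h; have wa : awf a by exact: awf_root.
  have w3 := wcons _ (awf_diff wr wa).
  have [s1 ws1 es1] := IH l a (adiff rr a :: Hd) wl wa w3.
  have [s2 ws2 es2] := IH l rr Hd wl wr wHd.
  have [s3 ws3 es3] := IH l rr (adiff rr a :: Hd) wl wr w3.
  exists (s1 ++ s2 ++ map (@tneg R E) s3); first exact: cat3.
  move=> z dz x hx; rewrite sum3 -es1 -?es2 -?es3 //; last 2 first.
  + by rewrite hprod_cons mulf_eq0 negb_or => /andP[_ /hx].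
  (* The guard a <= rr keeps the new upper bound at most 1. *)
  + rewrite hprod_cons mulf_eq0 negb_or aeval_diff subr_ge0.
    case: leP => [ar /andP[_ /hx[? ?]]|]; last by rewrite eqxx.
    by split => //; exact: le_trans ar _.
  rewrite hprod_cons aeval_diff subr_ge0.
  have root u : (0 <= aeval h [eta x with t |-> u]) = (u <= aeval a x).
    by rewrite aeval_root ?lt_eqF // nmulr_rge0 // subr_le0.
  have [ar|ra] := leP (aeval a x) (aeval rr x).
    rewrite mul1r addrK; congr (_ * cint01 _); apply/funext => u.
    rewrite integrand_cons root /integrand mulrA -rmorphM; congr (_%:C%C * _).
    have [ua|] := leP u (aeval a x); last by rewrite mul0r mulr0.
    by rewrite mul1r (le_trans ua ar).
  rewrite mul0r mul0r add0r mul0r subr0; congr (_ * cint01 _); apply/funext => u.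
  rewrite integrand_cons root /integrand mulrA -rmorphM; congr (_%:C%C * _).
  have [ua|au] := leP u (aeval a x); first by rewrite mul1r.
  by rewrite mul0r [u <= aeval rr x]leNgt (lt_trans ra au) mulr0.
- have qgt : 0 < (ratr (h.1 t) : R) by rewrite ltr0q.
  pose a := aroot t h; have wa : awf a by exact: awf_root.
  have w3 := wcons _ (awf_diff wa wl).
  have [s1 ws1 es1] := IH a rr (adiff a l :: Hd) wa wr w3.
  have [s2 ws2 es2] := IH l rr Hd wl wr wHd.
  have [s3 ws3 es3] := IH l rr (adiff a l :: Hd) wl wr w3.
  exists (s1 ++ s2 ++ map (@tneg R E) s3); first exact: cat3.
  move=> z dz x hx; rewrite sum3 -es1 -?es2 -?es3 //; last 2 first.
  + by rewrite hprod_cons mulf_eq0 negb_or => /andP[_ /hx].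
  + rewrite hprod_cons mulf_eq0 negb_or aeval_diff subr_ge0.
    case: leP => [la /andP[_ /hx[? ?]]|]; last by rewrite eqxx.
    by split => //; exact: le_trans la.
  rewrite hprod_cons aeval_diff subr_ge0.
  have root u : (0 <= aeval h [eta x with t |-> u]) = (aeval a x <= u).
    by rewrite aeval_root ?gt_eqF // pmulr_rge0 // subr_ge0.
  have [la|al] := leP (aeval l x) (aeval a x).
    rewrite mul1r addrK; congr (_ * cint01 _); apply/funext => u.
    rewrite integrand_cons root /integrand mulrA -rmorphM; congr (_%:C%C * _).
    have [au|] := leP (aeval a x) u; last by rewrite !mul0r.
    by rewrite mul1r (le_trans la au).
  rewrite mul0r mul0r add0r mul0r subr0; congr (_ * cint01 _); apply/funext => u.
  rewrite integrand_cons root /integrand mulrA -rmorphM; congr (_%:C%C * _).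
  have [au|ua] := leP (aeval a x) u; first by rewrite mul1r.
  by rewrite mul0r [aeval l x <= u]leNgt (lt_trans ua al) mul0r.
- have [s ws es] := IH l rr (h :: Hd) wl wr (wcons _ wh).
  exists s => // z dz x hx; rewrite -es //; last first.
    by rewrite hprod_cons mulf_eq0 negb_or => /andP[_ /hx].
  rewrite hprod_cons; have [h0|h0] := boolP (0 <= aeval h x).
    rewrite mul1r; congr (_ * cint01 _); apply/funext => u.
    by rewrite integrand_cons aeval_without // h0 mul1r.
  rewrite mul0r mul0r (_ : integrand _ _ _ _ _ _ _ _ _ _ = fun=> 0) ?cint01_0 ?mulr0 //.
  by apply/funext => u; rewrite integrand_cons aeval_without // (negPf h0) mul0r.
Qed.
End OneVariable.

(** Nonvanishing will be assumed only for the denominators of the final list, so it has to propagate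
    backwards, from the terms produced to the term integrated. *)
Lemma integrate_term t (S : pred E) b c tau : S t -> twf S b c tau ->
  exists2 s : seq (@term R E),
    (forall tau', tau' \in s -> twf (fun g => S g && (g != t)) b.+1 c.+1 tau') &
  forall z, (forall tau', tau' \in s -> nondeg z tau') -> nondeg z tau /\
    forall x, cint01 (fun u => teval z tau [eta x with t |-> u]) =
      \sum_(tau' <- s) teval z tau' x.
Proof.
case: tau => [[[[p L] psi] H] D] St [[hp hL hpsi hH] [hD hS hb hc]].
have [m [d [m0 hd]]] := clear_denominators (fun g => (psi g).1 t).
have w0 : awf (aconst 0) by rewrite -(rmorph0 (@ratr R)); exact: awf_const.
have w1 : awf (aconst 1) by rewrite -(rmorph1 (@ratr R)); exact: awf_const.
have [s ws es] := integrand_constraints hp hL hpsi hD hS hb hc St m0 hd hH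
  w0 w1 (fun h (hin : h \in [::]) => ltac:(by [])).
(* A zero term carrying all the denominators that were divided by. *)
pose dummy : @term R E :=
  (0, [::], [ffun g => asubst t (aconst 0) (psi g)], [::], D ++ nseq 1 d).
exists (dummy :: s).
  move=> tau'; rewrite inE => /orP[/eqP ->|/ws //]; split; split => //.
  - by rewrite -(rmorph0 (@ratr R)); exact: Qy_rat.
  - by move=> g; rewrite ffunE; exact: awf_subst.
  - by move=> ? /(den_neq0 hD hS St m0 hd).
  - exact: (psi_asubst hS).
  - by rewrite size_cat /= addn1 ltnS (leq_trans _ hb) // leq_addl.
  - by rewrite size_cat /= addn1.
move=> z nz; have nd := nz _ (mem_head _ _).
have d0 : dform d z != 0 by apply: nd; rewrite mem_cat mem_head orbT.
split; first by move=> e eD; apply: nd; rewrite mem_cat eD.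
move=> x; rewrite big_cons (_ : teval z dummy x = 0); last first.
  by rewrite /teval /= !mul0r.
rewrite add0r -es //; last first.
  by rewrite !aeval_const.
rewrite !aeval_const /hprod big_nil mul1r; apply: eq_cint01 => u /andP[u0 u1].
by rewrite /integrand u0 u1 !mul1r.
Qed.

Lemma integrate_terms t (S : pred E) b c l : S t ->
  (forall tau, tau \in l -> twf S b c tau) ->
  exists2 s : seq (@term R E),
    (forall tau', tau' \in s -> twf (fun g => S g && (g != t)) b.+1 c.+1 tau') &
  forall z, (forall tau', tau' \in s -> nondeg z tau') ->
    (forall tau, tau \in l -> nondeg z tau) /\
    forall x, unit_cube x ->
      cint01 (fun u => \sum_(tau <- l) teval z tau [eta x with t |-> u]) =
      \sum_(tau' <- s) teval z tau' x.
Proof.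
move=> St; elim: l => [|tau l IH] hl.
  exists [::] => // z _; split => // x _; rewrite big_nil.
  by rewrite -[RHS]cint01_0; apply: eq_cint01 => u _; rewrite big_nil.
have [s1 w1 e1] := integrate_term St (hl _ (mem_head _ _)).
have [|s2 w2 e2] := IH; first by move=> tau' h; apply: hl; rewrite inE h orbT.
exists (s1 ++ s2); first by move=> tau'; rewrite mem_cat => /orP[/w1|/w2].
move=> z nz.
have [n1 {}e1] := e1 z (fun tau' h => nz tau' ltac:(by rewrite mem_cat h)).
have [n2 {}e2] := e2 z (fun tau' h => nz tau' ltac:(by rewrite mem_cat h orbT)).
split; first by move=> tau'; rewrite inE => /orP[/eqP ->|/n2].
move=> x hx; rewrite big_cat -[RHS]/(_ + _) -e1 -(e2 _ hx).
rewrite -(@cint01_add _ _ (teval z tau) (fun x => \sum_(i <- l) teval z i x)) //.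
- by apply: eq_cint01 => u _; rewrite big_cons.
- exact: admissible_teval.
- by apply: admissible_sum => i; exact: admissible_teval.
Qed.

(** The head of [s] is the outermost variable, so the tail is integrated first, at every point of
    the cube; this includes the points where the head has been replaced by [u]. *)
Lemma iter_cint01_terms s b c l : uniq s ->
  (forall tau, tau \in l -> twf predT b c tau) ->
  exists2 l' : seq (@term R E),
    (forall tau', tau' \in l' ->
      twf (fun g => g \notin s) (b + size s) (c + size s) tau') &
  forall z, (forall tau', tau' \in l' -> nondeg z tau') ->
    forall x, unit_cube x ->
      iter_cint01 s (fun x => \sum_(tau <- l) teval z tau x) x =
      \sum_(tau' <- l') teval z tau' x.
Proof.
move=> us hl; elim: s us => [_|t s IH /andP[ts us]].
  by exists l => // tau /hl; rewrite /= !addn0; case: tau => [[[[? ?] ?] ?] ?].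
have [l1 w1 e1] := IH us.
have [l2 w2 e2] := @integrate_terms t (fun g => g \notin s) _ _ l1 ts w1.
exists l2.
  move=> tau /w2; case: tau => [[[[p L] psi] H] D] [h1 [h2 h3 h4 h5]].
  split => //; split; rewrite /= ?addnS //.
  by move=> g; rewrite inE negb_or => /andP[gt gs]; apply: h3; rewrite gs.
move=> z nz x hx; have [n1 {}e2] := e2 z nz; rewrite -e2 //=.
by apply: eq_cint01 => u hu; rewrite (e1 z n1) //; exact: unit_cube_with.
Qed.
End SymbolicIntegration.

(** * Bernoulli polynomials of fractional parts *)

Section PiecewisePolynomial.
Context {R : realType} {r : nat} (J : {set 'I_r}) (yc : 'I_r -> R) {E : finType}.
Implicit Types (x : E -> R) (rho : (E -> R) -> R).
Local Notation awf := (@awf R r J yc E).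

Definition rterm : Type := (rat * seq (@aform R E) * seq (@aform R E))%type.

Definition reval (q : rterm) x : R := ratr q.1.1 * aprod q.1.2 x * hprod q.2 x.

(** Equality is asked only on the cube: there a fractional part of an affine form has finitely many
    branches. *)
Definition pw (b : nat) rho : Prop := exists2 s : seq rterm,
  (forall q, q \in s -> [/\ forall a, a \in q.1.2 -> awf a,
     forall h, h \in q.2 -> awf h & (size q.1.2 <= b)%N]) &
  forall x, unit_cube x -> rho x = \sum_(q <- s) reval q x.

Lemma pw_single b (q : rterm) rho : (forall a, a \in q.1.2 -> awf a) ->
  (forall h, h \in q.2 -> awf h) -> (size q.1.2 <= b)%N ->
  (forall x, rho x = reval q x) -> pw b rho.
Proof.
move=> h1 h2 h3 e; exists [:: q]; first by move=> ?; rewrite inE => /eqP ->.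
by move=> x _; rewrite big_seq1.
Qed.

Lemma pw_cst b q : pw b (fun=> ratr q).
Proof.
apply: (@pw_single _ (q, [::], [::])) => // x.
by rewrite /reval /aprod /hprod !big_nil !mulr1.
Qed.

Lemma pw_add b rho1 rho2 : pw b rho1 -> pw b rho2 -> pw b (fun x => rho1 x + rho2 x).
Proof.
move=> [s1 h1 e1] [s2 h2 e2]; exists (s1 ++ s2).
  by move=> q; rewrite mem_cat => /orP[/h1|/h2].
by move=> x hx; rewrite e1 // e2 // big_cat.
Qed.

Lemma pw_mul b1 b2 rho1 rho2 : pw b1 rho1 -> pw b2 rho2 ->
  pw (b1 + b2) (fun x => rho1 x * rho2 x).
Proof.
move=> [s1 h1 e1] [s2 h2 e2].
exists [seq (q.1.1 * q'.1.1, q.1.2 ++ q'.1.2, q.2 ++ q'.2) | q <- s1, q' <- s2].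
  move=> q /allpairsP[[q1 q2] /= [/h1[a1 b1' c1] /h2[a2 b2' c2] ->]] /=; split.
  - by move=> a; rewrite mem_cat => /orP[/a1|/a2].
  - by move=> a; rewrite mem_cat => /orP[/b1'|/b2'].
  - by rewrite size_cat leq_add.
move=> x hx; rewrite e1 // e2 // big_allpairs_dep mulr_suml; apply: eq_bigr => q _.
rewrite mulr_sumr; apply: eq_bigr => q' _.
rewrite /reval /= /aprod /hprod !big_cat /= (rmorphM (@ratr R)) /=.
by move: (\prod_(_ <- _) _) (\prod_(_ <- _) _) (\prod_(_ <- _) _) (\prod_(_ <- _) _) (ratr _) (ratr _)
  => *; ring.
Qed.

Lemma pw_sum (T : Type) (l : seq T) b (rho : T -> (E -> R) -> R) :
  (forall i, pw b (rho i)) -> pw b (fun x => \sum_(i <- l) rho i x).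
Proof.
move=> h; elim: l => [|i l IH].
  under eq_fun do rewrite big_nil -(rmorph0 (@ratr R)).
  exact: pw_cst.
by under eq_fun do rewrite big_cons; exact: pw_add.
Qed.

Lemma pw_prod (T : Type) (l : seq T) (P : pred T) (b : T -> nat)
    (rho : T -> (E -> R) -> R) : (forall i, P i -> pw (b i) (rho i)) ->
  pw (\sum_(i <- l | P i) b i) (fun x => \prod_(i <- l | P i) rho i x).
Proof.
move=> h; elim: l => [|i l IH].
  rewrite (_ : (fun x => _) = fun=> ratr 1); first exact: pw_cst.
  by apply/funext => x; rewrite big_nil (rmorph1 (@ratr R)).
rewrite (_ : (fun x => _) = fun x =>
    if P i then rho i x * \prod_(j <- l | P j) rho j x
    else \prod_(j <- l | P j) rho j x); last first.
  by apply/funext => x; rewrite big_cons.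
by rewrite big_cons; case Pi : (P i) => //; apply: pw_mul => //; exact: h.
Qed.

Lemma pw_ge0 b h : awf h -> pw b (fun x => (0 <= aeval h x)%R%:R).
Proof.
move=> wh; apply: (@pw_single _ (1, [::], [:: h])) => //.
  by move=> h'; rewrite inE => /eqP ->.
by move=> x; rewrite /reval /aprod /hprod big_nil big_seq1 /= (rmorph1 (@ratr R)) !mul1r.
Qed.

Lemma bernoulli_polyE n : bernoulli_poly n =
  'X^n - (n.+1%:R)^-1 *: \sum_(j < n) 'C(n.+1, j)%:R *: bernoulli_poly j.
Proof.
rewrite {1}/bernoulli_poly /= nth_rcons size_bernoulli_polys ltnn eqxx.
by under eq_bigr => j _ do rewrite nth_bernoulli_polys ?ltn_ord //.
Qed.

Lemma size_bernoulli_poly n : (size (bernoulli_poly n) <= n.+1)%N.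
Proof.
elim/ltn_ind: n => n IH; rewrite bernoulli_polyE.
apply: leq_trans (size_polyD _ _) _; rewrite geq_max size_polyXn leqnn /= size_polyN.
apply: leq_trans (size_scale_leq _ _) _; apply: leq_trans (size_sum _ _ _) _.
apply/bigmax_leqP => j _; apply: leq_trans (size_scale_leq _ _) _.
by apply: leq_trans (IH _ (ltn_ord j)) _; rewrite ltnS ltnW.
Qed.

Lemma pw_bernoulli n a : awf a -> pw n (fun x => bernoulli n (aeval a x)).
Proof.
move=> wa; rewrite /bernoulli.
have hE x : (map_poly (@ratr R) (bernoulli_poly n)).[aeval a x] =
    \sum_(i < n.+1) ratr (bernoulli_poly n)`_i * aeval a x ^+ i.
  rewrite (@horner_coef_wide _ n.+1) ?size_map_poly ?size_bernoulli_poly //.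
  by apply: eq_bigr => i _; rewrite coef_map.
under eq_fun do rewrite hE.
apply: pw_sum => i; apply: (@pw_single _ ((bernoulli_poly n)`_i, nseq i a, [::])) => //.
- by move=> a' /=; rewrite mem_nseq => /andP[_ /eqP ->].
- by rewrite size_nseq -ltnS.
- by move=> x; rewrite /reval /aprod /hprod big_nil big_nseq iter_mulr_1 /= mulr1.
Qed.

Lemma aeval_bound a : exists M : nat, forall x, unit_cube x -> `|aeval a x| < M%:R.
Proof.
exists (Num.truncn (\sum_g `|ratr (a.1 g) : R| + `|a.2|)).+1 => x hx.
apply: le_lt_trans (truncnS_gt _); apply: le_trans (ler_normD _ _) _.
rewrite lerD2r; apply: le_trans (ler_norm_sum _ _ _) _; apply: ler_sum => g _.
have /andP[x0 x1] := hx g.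
by rewrite normrM ler_piMr // ger0_norm.
Qed.

(* On the cube, [f ({s}) = \sum_c f (s - c) (1_(s - c >= 0) - 1_(s - c - 1 >= 0))],
  [c] running over finitely many integers. *)
Lemma pw_bernoulli_fracpart n a : awf a ->
  pw n (fun x => bernoulli n (fracpart (aeval a x))).
Proof.
move=> wa; have [M hM] := aeval_bound a.
(* On the cube |a| < M, so the floor of [a] is one of the 2M integers i - M with i < M + M. *)
pose sh (i : nat) : @aform R E := adiff a (aconst (ratr (i%:Z - M%:Z)%:~R)).
have wsh i : awf (sh i) by apply: awf_diff => //; exact: awf_const.
have shE i x : aeval (sh i) x = aeval a x - (i%:Z - M%:Z)%:~R.
  by rewrite aeval_diff aeval_const ratr_int.
have [s hs es] : pw n (fun x => \sum_(i < M + M) bernoulli n (aeval (sh i) x) *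
   ((0 <= aeval (sh i) x)%R%:R + ratr (-1) * (0 <= aeval (sh i.+1) x)%R%:R)).
  apply: pw_sum => i; rewrite -[n in pw n _]addn0; apply: pw_mul.
    exact: pw_bernoulli.
  apply: pw_add; first exact: pw_ge0.
  by rewrite -[0%N]addn0; apply: pw_mul; [exact: pw_cst|exact: pw_ge0].
exists s => // x hx; rewrite -es // {hs es}.
have /andP[f1 f2] := floor_itv (aeval a x).
set f := Num.floor (aeval a x) in f1 f2 *.
have := hM x hx; rewrite ltr_norml => /andP[M1 M2].
have fM1 : - M%:Z <= f.
  by rewrite /f real_floor_ge_int ?num_real // rmorphN ltW.
have fM2 : f < M%:Z by rewrite -(ltr_int R) (le_lt_trans f1).
have jE : (absz (f + M%:Z))%:Z = f + M%:Z by rewrite gez0_abs //; lia.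
have jlt : (absz (f + M%:Z)%R < M + M)%N by lia.
have ge i : (0 <= aeval (sh i) x) = (i%:Z - M%:Z <= f).
  by rewrite shE subr_ge0 /f real_floor_ge_int ?num_real.
rewrite (bigD1 (Ordinal jlt)) //= big1 ?addr0.
  rewrite !ge jE addrK lexx (_ : (_ <= _) = false); last by lia.
  by rewrite mulr0 addr0 mulr1 shE jE addrK.
move=> i /eqP ij; rewrite !ge (rmorphN (@ratr R)) /= (rmorph1 (@ratr R)).
(* The difference of indicators is 1 only if i - M <= f < i + 1 - M, that is, for the index already
   split off. *)
case: (lerP (i%:Z - M%:Z) f) => h1; case: (lerP (i.+1%:Z - M%:Z) f) => h2.
- by rewrite mulr1 subrr mulr0.
- by case: ij; apply: val_inj => /=; lia.
- lia.
- by rewrite mulr0 addr0 mulr0.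
Qed.

Lemma admissible_sum_reval (s : seq rterm) :
  admissible (fun x => (\sum_(q <- s) reval q x)%:C%C).
Proof.
under eq_fun do rewrite rmorph_sum /=.
apply: admissible_sum => q; under eq_fun do rewrite /reval !(rmorphM (real_complex R)) /=.
apply: admissible_mul; last exact: admissible_hprod.
apply: admissible_mul; [exact: admissible_cst|exact: admissible_aprod].
Qed.
End PiecewisePolynomial.

(** * The explicit formula *)

Section Formula.
Context {R : realType} {r : nat} (J : {set 'I_r}) (yc : 'I_r -> R) {E : finType}.
Local Notation awf := (@awf R r J yc E).
Local Notation origin := (fun=> 0 : R).

(** After all integrations the point left is the base point of the iterated integral, the origin. An
    affine form is there its constant term, in the Q-span of 1 and the y_i, and an indicator is 0 or
    1; the value thus has the required form. *)
Definition tnum (kappa : rat) (tau : @term R E) (z : 'rV[R[i]]_#|E|) : R[i] :=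
  let: (p, L, psi, H, D) := tau in
  (ratr kappa * (p * aprod L origin * hprod H origin))%:C%C *
  cexp (pii R * zform (fun g => (psi g).2) z).

Definition tden (tau : @term R E) (z : 'rV[R[i]]_#|E|) : R[i] :=
  \prod_(d <- tau.2) dform d z.

Lemma aeval_origin (a : @aform R E) : aeval a origin = a.2.
Proof. by rewrite /aeval big1 ?add0r // => g _; rewrite mulr0. Qed.

Lemma tnum_numerators kappa S b c tau : twf J yc S b c tau ->
  numerators J yc (tnum kappa tau).
Proof.
case: tau => [[[[p L] psi] H] D] [[hp hL hpsi hH] _].
exists (ratr kappa * (p * aprod L origin * hprod H origin)), (fun g => (psi g).2).
split; [|exact: hpsi|by []]; apply: Qy_mul; first exact: Qy_rat.
apply: Qy_mul; first apply: Qy_mul => //.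
  elim: L hL => [|a L IH] hL; first by rewrite /aprod big_nil -(rmorph1 (@ratr R)); exact: Qy_rat.
  rewrite aprod_cons aeval_origin; apply: Qy_mul.
    by apply: Qy_QAy; apply: hL; rewrite mem_head.
  by apply: IH => a' h; apply: hL; rewrite inE h orbT.
elim: H {hH} => [|a H IH]; first by rewrite /hprod big_nil -(rmorph1 (@ratr R)); exact: Qy_rat.
by rewrite hprod_cons; apply: Qy_mul => //; rewrite -ratr_nat; exact: Qy_rat.
Qed.

Lemma tden_denominators m S b c tau : twf J yc S b c tau -> size tau.2 = m ->
  denominators J yc m (tden tau).
Proof.
case: tau => [[[[p L] psi] H] D] [_ [hD _ _ _]] /= sz.
pose a (i : 'I_m) g : R := (nth [ffun=> 0] D i g)%:~R.
exists a; split.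
- move=> i g; exists (fun=> 0), (nth [ffun=> 0] D i g).
  by rewrite big1 ?add0r // => j _; rewrite mul0r.
- move=> i; have iD : (i < size D)%N by rewrite sz.
  have [g hg] := hD _ (mem_nth [ffun=> 0] iD).
  by exists g; rewrite intr_eq0.
- by apply/funext => z; rewrite /tden /= (big_nth [ffun=> 0]) sz big_mkord.
Qed.

(** Each denominator carries one factor pi i; pulling them out gives the exponent K - (k + N) once
    the terms are grouped by their number of denominators. *)
Lemma teval_origin kappa K tau z :
  pii R ^+ K * (ratr kappa)%:C%C * teval z tau origin =
  pii R ^ (K%:Z - (size tau.2)%:Z) * (tnum kappa tau z / tden tau z).
Proof.
case: tau => [[[[p L] psi] H] D] /=; rewrite /tden /=.
have -> : dprod D z = pii R ^+ size D * \prod_(d <- D) dform d z.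
  by rewrite /dprod big_split /= big_const_seq count_predT iter_mulr_1.
have -> : texp psi z origin = cexp (pii R * zform (fun g => (psi g).2) z).
  by rewrite /texp; congr (cexp (_ * _)); apply: eq_bigr => g _; rewrite aeval_origin.
rewrite expfzDr ?pii_neq0 // -exprnN -exprnP invfM.
rewrite [in RHS](rmorphM (real_complex R)) /=.
by move: (_%:C%C) (_%:C%C) (cexp _) (\prod_(_ <- _) _) => *; ring.
Qed.

Lemma iter_cint01_formula (K : nat) (kappa : rat) (rho : (E -> R) -> R) :
  pw J yc K rho ->
  exists (T : 'I_K.+1 -> finType)
         (num den : forall j, T j -> 'rV[R[i]]_#|E| -> R[i]),
    [/\ forall (j : 'I_K.+1) (e : T j), numerators J yc (num j e),
        forall (j : 'I_K.+1) (e : T j), denominators J yc (j + #|E|)%N (den j e) &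
        forall z, (forall (j : 'I_K.+1) (e : T j), den j e z != 0) ->
          pii R ^+ K * (ratr kappa)%:C%C * iter_cint01 (enum {: E})
            (fun x => cexp (- (2 * pii R * zform x z)) * (rho x)%:C%C) origin =
          \sum_(j < K.+1) pii R ^ (K%:Z - (j + #|E|)%N%:Z) *
            \sum_(e : T j) num j e z / den j e z].
Proof.
move=> [s hs es].
(* The initial terms have exponent -2 x_g in each z_g and no denominators, hence the bounds [K] and
   0. *)
pose tm (q : @rterm R E) : @term R E :=
  (ratr q.1.1, q.1.2, [ffun g => psi0 g], q.2, [::]).
have [|l wl el] := @iter_cint01_terms R r J yc E (enum {: E}) K 0 (map tm s) (enum_uniq _).
  move=> tau /mapP[q /hs[h1 h2 h3] ->]; split; split => //.
  - exact: Qy_rat.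
  - by move=> g; rewrite ffunE /awf /= -(rmorph0 (@ratr R)); exact: QAy_rat.
  - by move=> g _; rewrite ffunE.
  - by rewrite addn0.
rewrite -cardE add0n in wl.
pose d0 : @term R E := (0, [::], [ffun=> aconst 0], [::], [::]).
pose lj (j : nat) := [seq tau <- l | size tau.2 == (j + #|E|)%N].
have ljP j (e : 'I_(size (lj j))) :
    nth d0 (lj j) e \in l /\ size (nth d0 (lj j) e).2 = (j + #|E|)%N.
  by have := mem_nth d0 (ltn_ord e); rewrite mem_filter => /andP[/eqP].
exists (fun j : 'I_K.+1 => 'I_(size (lj j)) : finType),
  (fun (j : 'I_K.+1) (e : 'I_(size (lj j))) => tnum kappa (nth d0 (lj j) e)),
  (fun (j : 'I_K.+1) (e : 'I_(size (lj j))) => tden (nth d0 (lj j) e)); split.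
- by move=> j e; apply: tnum_numerators; apply: wl; have [] := ljP _ e.
- move=> j e; have [h1 h2] := ljP _ e.
  exact: tden_denominators (wl _ h1) h2.
move=> z dz.
(* The two counts in [twf] give N <= size D <= K + N, so each term belongs to exactly one group. *)
have szl tau : tau \in l -> exists2 j : 'I_K.+1, size tau.2 = (j + #|E|)%N &
    forall j' : 'I_K.+1, (size tau.2 == (j' + #|E|)%N) = (j' == j).
  move=> /wl; case: tau => [[[[p L] psi] H] D] [_ [_ _ h1 h2]] /=.
  have h3 : (size D - #|E| < K.+1)%N.
    by rewrite ltnS leq_subLR addnC (leq_trans _ h1) // leq_addl.
  exists (Ordinal h3) => /=; first by rewrite subnK.
  move=> j'; apply/eqP/eqP => [h|->]; last by rewrite /= subnK.
  by apply: val_inj; rewrite /= h addnK.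
have nz tau : tau \in l -> nondeg z tau.
  move=> tl; have [j sz _] := szl _ tl.
  have tlj : tau \in lj j by rewrite mem_filter sz eqxx.
  have hi : (index tau (lj j) < size (lj j))%N by rewrite index_mem.
  have := dz j (Ordinal hi); rewrite /= nth_index // => h d dD.
  by apply: contra h => /eqP d0z; rewrite /tden (big_rem d) //= d0z mul0r.
transitivity (\sum_(tau <- l) pii R ^ (K%:Z - (size tau.2)%:Z) *
    (tnum kappa tau z / tden tau z)).
  rewrite (_ : iter_cint01 _ _ _ = \sum_(tau <- l) teval z tau origin).
    by rewrite mulr_sumr; apply: eq_bigr => tau _; rewrite teval_origin.
  rewrite -el //; last by move=> t; rewrite lexx ler01.
  apply: eq_iter_cint01; last by move=> t; rewrite lexx ler01.
  move=> x hx; rewrite es // rmorph_sum mulr_sumr big_map; apply: eq_bigr => q _.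
  rewrite /tm /teval /dprod big_nil divr1 /reval mulrC; congr (_ * _).
  rewrite /texp /zform !mulr_sumr -sumrN; congr (cexp _); apply: eq_bigr => g _.
  have -> : aeval ([ffun g => psi0 g] g) x = - (2 * x g).
    rewrite ffunE /aeval /= addr0 (bigD1 g) //= ffunE eqxx big1 ?addr0.
      by rewrite (rmorphN (@ratr R)) /= ratr_nat mulNr.
    by move=> h /negPf hg; rewrite ffunE hg (rmorph0 (@ratr R)) mul0r.
  rewrite (rmorphN (real_complex R)) (rmorphM (real_complex R)) /=.
  rewrite (rmorph_nat (real_complex R)); ring.
transitivity (\sum_(tau <- l) \sum_(j < K.+1) if size tau.2 == (j + #|E|)%N then
   pii R ^ (K%:Z - (j + #|E|)%N%:Z) * (tnum kappa tau z / tden tau z) else 0).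
  rewrite !big_seq; apply: eq_bigr => tau tl; have [j sz hj] := szl _ tl.
  rewrite -big_mkcond /= (eq_bigl _ _ hj) big_pred1_eq sz //.
rewrite exchange_big; apply: eq_bigr => j _ /=.
rewrite -big_mkcond -big_filter -/(lj j) -mulr_sumr (big_nth d0) big_mkord.
by congr (_ * _); apply: eq_bigr.
Qed.
End Formula.

(** * Integrality from the root data, and the theorem *)

Section RootData.
Context {R : realType} {V : vectType R} (ip : {dot V for idfun}) {r : nat}.

(** Coroots and fundamental weights being dual, the pairings of the eta_gamma with the mu_i are
    integers; this makes the slopes inside the fractional parts rational. *)
Lemma ip_Zspan_int (J1 J2 : {set 'I_r}) (b c : 'I_r -> V) u v :
  (forall i j, ip (b i) (c j) = (i == j)%:R) ->
  Zspan J1 b u -> Zspan J2 c v -> exists n : int, ip u v = n%:~R.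
Proof.
move=> bc [m ->] [n ->].
exists (\sum_(i in J1) \sum_(j in J2) m i * n j * (i == j)%:R).
rewrite linear_sumlz rmorph_sum; apply: eq_bigr => i _ /=.
rewrite linear_sumr rmorph_sum; apply: eq_bigr => j _ /=.
by rewrite linearZl_LR linearZr_LR /= bc !rmorphM /= rmorph_nat mulrA.
Qed.

(** Identifies |k| with the total degree of the two products of Bernoulli polynomials. Injectivity
    of [gam] prevents an element of B from being counted twice. *)
Lemma sum_Dmin (I : {set 'I_r}) (D : {fset V * R}) (gam : 'I_r -> V * R)
    (k : V * R -> nat) :
  (forall i, i \in ~: I -> gam i \in D) -> {in ~: I &, injective gam} ->
  (\sum_(h <- D) k h =
   \sum_(g : Dmin I D gam) k (val g) + \sum_(i in ~: I) k (gam i))%N.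
Proof.
move=> hBD inj; rewrite -(big_seq_fsetE _ _ predT) /=.
rewrite -[X in (_ + X)%N]big_enum -(big_map gam predT) -big_cat; apply: perm_big.
apply: uniq_perm => [||h]; first exact: fset_uniq.
  rewrite cat_uniq fset_uniq map_inj_in_uniq ?enum_uniq ?andbT; last first.
    by move=> i j; rewrite !mem_enum; exact: inj.
  apply/hasPn => h hh; have [j] := seq.mapP hh; rewrite mem_enum => jI ->.
  by rewrite !inE negb_and negbK; apply/orP; left; apply/imfsetP; exists j.
rewrite mem_cat /Dmin !inE; apply/idP/idP => [hD|/orP[/andP[] //|hh]].
  have [h1|h1] := boolP (h \in [fset gam i | i in ~: I]%fset); last by rewrite hD.
  by move: h1 => /imfsetP[i /= iI ->]; rewrite map_f ?orbT // mem_enum.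
by have [j] := seq.mapP hh; rewrite mem_enum => jI ->; exact: hBD.
Qed.
End RootData.

Theorem theorem3p5 (R : realType) (r : nat)
    (V : vectType R) (ip : {dot V for idfun}) (dimV : \dim {:V} = r)
    (Delta : {fset V}) (hDelta : reduced_root_system ip Delta)
    (alpha : 'I_r -> V) (halpha : fundamental_system Delta alpha)
    (lambda : 'I_r -> V)
    (hlambda : forall i j,
       ip (coroot ip (alpha i)) (lambda j) = (i == j)%:R)
    (I : {set 'I_r})
    (D : {fset V * R})
    (hD : forall g, g \in D ->
       [/\ Zspan [set: 'I_r] (fun i => coroot ip (alpha i)) g.1,
           g.1 <> 0 & g.2 \is a Num.int])
    (gam : 'I_r -> V * R)
    (hBD : forall i, i \in ~: I -> gam i \in D)
    (heta : Zbasis (~: I) (fun i => (gam i).1)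
              (Zspan (~: I) (fun i => coroot ip (alpha i))))
    (mu : 'I_r -> V)
    (hmuP : forall i, i \in ~: I -> Zspan (~: I) lambda (mu i))
    (hmu : forall i j, i \in ~: I -> j \in ~: I ->
       ip (gam i).1 (mu j) = (i == j)%:R)
    (k : V * R -> nat)
    (hk1 : forall g, g \in D -> (1 <= k g)%N)
    (hk2 : forall i, i \in ~: I -> (2 <= k (gam i))%N)
    (y : V) (hy : y \in <<[seq alpha i | i in ~: I]>>%VS)
    (f g gsharp : V -> R[i])
    (hf : forall lam m, Nspan I lambda lam -> Zspan (~: I) lambda m ->
       f (lam + m) = f lam * cexp (2 * pii R * (ip y m)%:C%C))
    (hg : forall lam m, Nspan I lambda lam -> Zspan (~: I) lambda m ->
       g (lam + m) =
       gsharp lam * \prod_(h <- D) ((aff ip h (lam + m))%:C%C ^+ k h))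
    (hS : summable
       [set v | (exists lam m, [/\ Nspan I lambda lam,
                   Zspan (~: I) lambda m & v = lam + m]) /\ g v != 0]
       (fun v => (complex.Re `|f v / g v|)%:E)) :
  let E := Dmin I D gam in
  let N := #|{: E}| in
  let K := (\sum_(h <- D) k h)%N in
  let nu := nu_vec I gam mu in
  let yc := fun i => ip y (mu i) in
  exists (J : 'I_K.+1 -> finType)
         (num den : forall j, J j -> 'rV[R[i]]_N -> R[i]),
    (forall (j : 'I_K.+1) (e : J j), numerators (~: I) yc (num j e)) /\
    (forall (j : 'I_K.+1) (e : J j),
       denominators (~: I) yc (j + N)%N (den j e)) /\
    exists F : 'rV[R[i]]_N -> R[i],
      [/\ entire F,
          forall z, (forall (j : 'I_K.+1) (e : J j), den j e z != 0) ->
            F z = \sum_(j < K.+1) pii R ^ (K%:Z - (j + N)%N%:Z) *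
                    \sum_(e : J j) num j e z / den j e z
        & forall lam, Zspan I lambda lam ->
            fsharp ip I D gam mu k y lam =
            cexp (- (2 * pii R * (ip y nu)%:C%C)) * F (zpoint ip E nu lam)].
Proof.
move=> {f g gsharp hf hg hS} E N K nu yc.
have gam_inj : {in ~: I &, injective gam}.
  move=> i j hi hj e; have := hmu i j hi hj; rewrite e hmu // eqxx.
  by case: eqP => // _ /eqP; rewrite oner_eq0.
have ip_int (g : E) i : i \in ~: I -> exists n : int, ip (val g).1 (mu i) = n%:~R.
  move=> hi; have gD : val g \in D by have := valP g; rewrite inE => /andP[].
  have [gQ _ _] := hD _ gD.
  exact: (ip_Zspan_int (b := fun i => coroot ip (alpha i)) hlambda gQ (hmuP i hi)).
pose rho (x : E -> R) := (\prod_(g : E) bernoulli (k (val g)) (x g)) *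
  (\prod_(i in ~: I) bernoulli (k (gam i))
     (fracpart (ip y (mu i) - \sum_(g : E) x g * ip (val g).1 (mu i)))).
have pw_rho : pw (~: I) yc K rho.
  rewrite /K (sum_Dmin k hBD gam_inj); apply: pw_mul.
    apply: pw_prod => g _.
    pose a : @aform R E := ([ffun h => if h == g then 1 else 0], 0).
    rewrite (_ : (fun x => _) = fun x => bernoulli (k (val g)) (aeval a x)).
      by apply: pw_bernoulli; rewrite /awf /= -(rmorph0 (@ratr R)); exact: QAy_rat.
    apply/funext => x; congr bernoulli.
    rewrite /aeval /= addr0 (bigD1 g) //= ffunE eqxx big1 ?addr0.
      by rewrite (rmorph1 (@ratr R)) mul1r.
    by move=> h /negPf hg; rewrite ffunE hg (rmorph0 (@ratr R)) mul0r.
  apply: pw_prod => i hi.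
  pose n (g : E) : int := xget 0 [set n : int | ip (val g).1 (mu i) = n%:~R].
  have nE g : ip (val g).1 (mu i) = (n g)%:~R.
    by rewrite /n; case: xgetP => [m _ //|h]; have [m /h] := ip_int g i hi.
  pose a : @aform R E := ([ffun g => - (n g)%:~R], ip y (mu i)).
  rewrite (_ : (fun x => _) = fun x => bernoulli (k (gam i)) (fracpart (aeval a x))).
    by apply: pw_bernoulli_fracpart; exact: QAy_coord.
  apply/funext => x; congr (bernoulli _ (fracpart _)).
  rewrite /aeval /= addrC -sumrN; congr (_ + _); apply: eq_bigr => g _.
  by rewrite ffunE (rmorphN (@ratr R)) /= ratr_int nE mulNr mulrC.
(* What remains of the constant in [fsharp] after extracting (pi i)^K from the powers of 2 pi i. *)
pose kappa : rat := (-1) ^+ #|` D| * \prod_(g <- D) (2 ^+ k g / ((k g)`!)%:R).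
have kappaE : (-1) ^+ #|` D| * (\prod_(g <- D) ((2 * pii R) ^+ k g / ((k g)`!)%:R)) =
    pii R ^+ K * (ratr kappa)%:C%C.
  pose phi : {rmorphism rat -> R[i]} := (real_complex R \o @ratr R)%FUN.
  rewrite -[(ratr kappa)%:C%C]/(phi kappa) /kappa rmorphM rmorph_sign rmorph_prod /=.
  rewrite [RHS]mulrCA; congr (_ * _).
  rewrite /K -prodrXr -big_split /=; apply: eq_bigr => g _.
  by rewrite -[real_complex R _]/(phi _) fmorph_div rmorphXn !rmorph_nat exprMn; ring.
have [T [num [den [hnum hden hF]]]] := iter_cint01_formula kappa pw_rho.
pose F z := pii R ^+ K * (ratr kappa)%:C%C * iter_cint01 (enum {: E})
  (fun x => cexp (- (2 * pii R * zform x z)) * (rho x)%:C%C) (fun=> 0).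
exists T, num, den; do 2 split => //; exists F; split => //.
- have [s _ es] := pw_rho.
  have o : unit_cube (fun _ : E => 0 : R) by move=> g; rewrite lexx ler01.
  (* Admissibility is available for the finite sum of [reval] terms, which agrees with [rho] on the
     cube; the integral sees nothing else. *)
  rewrite (_ : F = fun z => pii R ^+ K * (ratr kappa)%:C%C * iter_cint01 (enum {: E})
    (fun x => cexp (- (2 * pii R * zform x z)) * (\sum_(q <- s) reval q x)%:C%C)
    (fun=> 0)).
    apply: entire_iter_cint01 => //; exact: admissible_sum_reval.
  apply/funext => z; congr (_ * _); apply: eq_iter_cint01 => // x hx.
  by rewrite es.
- move=> lam _; rewrite /fsharp -/E -/nu /F -kappaE.
  rewrite [_ * cexp _]mulrC -!mulrA; do 4 congr (_ * _).
  apply: (congr1 (fun h => iter_cint01 (enum {: E}) h (fun=> 0))); apply/funext => x.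
  rewrite /rho [in RHS](rmorphM (real_complex R)) /= [RHS]mulrA; congr (_ * _ * _).
  congr (cexp (- (_ * _))).
  rewrite /zform rmorph_sum; apply: eq_bigr => g _.
  by rewrite mxE enum_rankK (rmorphM (real_complex R)) /= mulrC.
Qed.
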